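(* Let $R$ be a commutative local noetherian ring with completion $\widehat{R}$, and let $P_R$ be an $R$-module. Then $P$ is pure-projective (as an $R$-module) if and only if $P\otimes_R\widehat{R}$ is pure-projective (as an $\widehat{R}$-module).
   Context: $\widehat{R}$ is the $\mathfrak{m}$-adic completion of $R$, where $\mathfrak{m}$ is the maximal ideal of $R$. A module is pure-projective if it is isomorphic to a direct summand of a direct sum of finitely presented modules (equivalently, it is projective with respect to pure exact sequences). *)

(* Defs.v *)
From HB Require Import structures.
From mathcomp Require Import all_boot all_order all_algebra.
From mathcomp Require Import boolp classical_sets functions cardinality.
From mathcomp.multinomials Require Import freeg.

Set Implicit Arguments.
Unset Strict Implicit.
Unset Printing Implicit Defensive.

Import GRing.Theory.
Local Open Scope ring_scope.
Local Open Scope classical_set_scope.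
Local Open Scope quotient_scope.

Section Ideals.
Context {R : comPzRingType}.

Definition is_ideal (I : set R) : Prop :=
  [/\ I 0, forall x y, I x -> I y -> I (x + y) & forall a x, I x -> I (a * x)].

Record ideal := Ideal { ideal_set :> R -> Prop; _ : is_ideal ideal_set }.

Lemma idealP (I : ideal) : is_ideal I. Proof. by case: I. Qed.

Definition maximal_ideal (I : ideal) : Prop :=
  ~ I 1 /\ forall J : ideal,
    ideal_set I `<=` ideal_set J -> ~ J 1 -> ideal_set J `<=` ideal_set I.

Lemma is_ideal_setT : is_ideal [set: R]. Proof. by []. Qed.

Definition ideal_mul_set (I J : set R) : set R :=
  [set x | exists n (a b : 'I_n -> R),
     [/\ forall i, I (a i), forall i, J (b i) & x = \sum_i a i * b i]].

Lemma is_ideal_mul (I J : ideal) : is_ideal (ideal_mul_set I J).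
Proof.
split.
- by exists 0%N, (fun=> 0), (fun=> 0); split; [case|case|rewrite big_ord0].
- move=> _ _ [n [a [b [Ia Jb ->]]]] [k [c [d [Ic Jd ->]]]].
  pose cat (f : 'I_n -> R) (g : 'I_k -> R) i :=
    match fintype.split i with inl j => f j | inr j => g j end.
  exists (n + k)%N, (cat a c), (cat b d); split.
  + by move=> i; rewrite /cat; case: (fintype.split i).
  + by move=> i; rewrite /cat; case: (fintype.split i).
  + rewrite big_split_ord /=; congr (_ + _); apply: eq_bigr => i _; rewrite /cat.
      by rewrite (unsplitK (inl i)).
    by rewrite (unsplitK (inr i)).
- move=> r _ [n [a [b [Ia Jb ->]]]]; exists n, (fun i => r * a i), b; split=> //.
    by move=> i; case: (idealP I) => _ _; apply.
  by rewrite mulr_sumr; apply: eq_bigr => i _; rewrite mulrA.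
Qed.

Definition ideal_mul (I J : ideal) : ideal := Ideal (is_ideal_mul I J).

Fixpoint ideal_pow (I : ideal) (n : nat) : ideal :=
  if n is k.+1 then ideal_mul I (ideal_pow I k) else Ideal is_ideal_setT.

End Ideals.

Arguments ideal R : clear implicits.

Definition noetherian (R : comPzRingType) : Prop :=
  forall I : ideal R, exists n (g : 'I_n -> R),
    forall x, I x <-> exists c : 'I_n -> R, x = \sum_i c i * g i.

Definition local_ring (R : comPzRingType) (m : ideal R) : Prop :=
  maximal_ideal m /\
  forall m' : ideal R, maximal_ideal m' -> ideal_set m' = ideal_set m.

(* The library's [{ideal_quot I}] only covers proper ideals of nontrivial
   rings; the quotients R / m ^ n below include the case n = 0. *)
Section ResidueRing.
Context {R : comPzRingType} (I : ideal R).

Definition ideal_pred : {pred R} := fun x => `[< I x >].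

Lemma ideal_pred_zmod_closed : zmod_closed ideal_pred.
Proof.
have [I0 ID IM] := idealP I; split; first exact/asboolP.
move=> x y /asboolP Ix /asboolP Iy; apply/asboolP.
by rewrite -[- y]mulN1r; apply: ID => //; apply: IM.
Qed.

HB.instance Definition _ :=
  GRing.isZmodClosed.Build R ideal_pred ideal_pred_zmod_closed.

Definition residue_ring : Type := Quotient.quot ideal_pred.
HB.instance Definition _ := GRing.Zmodule.on residue_ring.

Definition residue (x : R) : residue_ring := \pi_(Quotient.quot ideal_pred) x.

Lemma residue_eq x y : residue x = residue y <-> I (x - y).
Proof.
split=> [/eqP|Ixy]; last apply/eqP.
  by rewrite /residue -Quotient.idealrBE => /asboolP.
by rewrite /residue -Quotient.idealrBE; apply/asboolP.
Qed.

Lemma residue_surj (u : residue_ring) : exists x, residue x = u.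
Proof. by exists (repr u); exact: reprK. Qed.

Lemma residue_is_zmod_morphism : zmod_morphism residue.
Proof. by move=> x y; rewrite /residue raddfB. Qed.

HB.instance Definition _ :=
  GRing.isZmodMorphism.Build R residue_ring residue residue_is_zmod_morphism.

Definition residue_mul (u v : residue_ring) : residue_ring :=
  residue (repr u * repr v).

Lemma residueM x y : residue (x * y) = residue_mul (residue x) (residue y).
Proof.
have [I0 ID IM] := idealP I.
have reprE z : I (z - repr (residue z)).
  by apply/residue_eq; symmetry; exact: reprK.
apply/residue_eq; set x' := repr _; set y' := repr _.
have -> : x * y - x' * y' = y * (x - x') + x' * (y - y').
  by rewrite !mulrBr ![y * _]mulrC addrA subrK.
by apply: ID; apply: IM; apply: reprE.
Qed.

Lemma residue_mulA : associative residue_mul.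
Proof.
move=> u v w; have [[x <-] [y <-] [z <-]] := And3 (residue_surj u) (residue_surj v) (residue_surj w).
by rewrite -!residueM mulrA.
Qed.

Lemma residue_mulC : commutative residue_mul.
Proof. by move=> u v; rewrite /residue_mul mulrC. Qed.

Lemma residue_mul1 : left_id (residue 1) residue_mul.
Proof. by move=> u; have [x <-] := residue_surj u; rewrite -residueM mul1r. Qed.

Lemma residue_mulDl : left_distributive residue_mul +%R.
Proof.
move=> u v w; have [[x <-] [y <-] [z <-]] := And3 (residue_surj u) (residue_surj v) (residue_surj w).
by rewrite -raddfD -!residueM mulrDl raddfD.
Qed.

HB.instance Definition _ := GRing.Zmodule_isComPzRing.Build residue_ring
  residue_mulA residue_mulC residue_mul1 residue_mulDl.

Lemma residue_is_monoid_morphism : monoid_morphism residue.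
Proof. by split=> // x y; exact: residueM. Qed.

HB.instance Definition _ :=
  GRing.isMonoidMorphism.Build R residue_ring residue residue_is_monoid_morphism.

End ResidueRing.

Section Completion.
Context {R : comPzRingType} (m : ideal R).

(* The transition maps R / m ^ n.+1 -> R / m ^ n send the class of x to the
   class of x, so compatibility of u asks that two consecutive components have
   a common representative. *)
Definition compatible (u : forall n, residue_ring (ideal_pow m n)) : Prop :=
  forall n, exists x : R,
    residue (ideal_pow m n.+1) x = u n.+1 /\ residue (ideal_pow m n) x = u n.

(* the inverse limit of the rings R / m ^ n *)
Record completion := Completion {
  completion_proj :> forall n, residue_ring (ideal_pow m n);
  completionP : compatible completion_proj }.

HB.instance Definition _ := gen_eqMixin completion.
HB.instance Definition _ := gen_choiceMixin completion.

Lemma completion_ext (u v : completion) : (forall n, u n = v n) -> u = v.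
Proof.
case: u v => [u cu] [v cv] /= uv.
have E : u = v by apply: functional_extensionality_dep.
by subst v; congr Completion; exact: Prop_irrelevance.
Qed.

Lemma compatible_cst (r : R) : compatible (fun n => residue (ideal_pow m n) r).
Proof. by move=> n; exists r. Qed.

Lemma compatible_opp (u : completion) : compatible (fun n => - u n).
Proof.
by move=> n; have [x [<- <-]] := completionP u n; exists (- x); rewrite !raddfN.
Qed.

Lemma compatible_add (u v : completion) : compatible (fun n => u n + v n).
Proof.
move=> n; have [x [<- <-]] := completionP u n.
by have [y [<- <-]] := completionP v n; exists (x + y); rewrite !raddfD.
Qed.

Lemma compatible_mul (u v : completion) : compatible (fun n => u n * v n).
Proof.
move=> n; have [x [<- <-]] := completionP u n.
by have [y [<- <-]] := completionP v n; exists (x * y); rewrite !rmorphM.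
Qed.

Definition to_completion (r : R) : completion := Completion (compatible_cst r).

Let add u v := Completion (compatible_add u v).
Let opp u := Completion (compatible_opp u).
Let mul u v := Completion (compatible_mul u v).

Fact completion_addA : associative add.
Proof. by move=> u v w; apply: completion_ext => n; exact: addrA. Qed.
Fact completion_addC : commutative add.
Proof. by move=> u v; apply: completion_ext => n; exact: addrC. Qed.
Fact completion_add0 : left_id (to_completion 0) add.
Proof. by move=> u; apply: completion_ext => n; rewrite /= raddf0 add0r. Qed.
Fact completion_addN : left_inverse (to_completion 0) opp add.
Proof. by move=> u; apply: completion_ext => n; rewrite /= raddf0 addNr. Qed.

HB.instance Definition _ := GRing.isZmodule.Build completion
  completion_addA completion_addC completion_add0 completion_addN.

Fact completion_mulA : associative mul.
Proof. by move=> u v w; apply: completion_ext => n; exact: mulrA. Qed.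
Fact completion_mulC : commutative mul.
Proof. by move=> u v; apply: completion_ext => n; exact: mulrC. Qed.
Fact completion_mul1 : left_id (to_completion 1) mul.
Proof. by move=> u; apply: completion_ext => n; rewrite /= rmorph1 mul1r. Qed.
Fact completion_mulDl : left_distributive mul +%R.
Proof. by move=> u v w; apply: completion_ext => n; exact: mulrDl. Qed.

HB.instance Definition _ := GRing.Zmodule_isComPzRing.Build completion
  completion_mulA completion_mulC completion_mul1 completion_mulDl.

Fact to_completion_is_zmod_morphism : zmod_morphism to_completion.
Proof. by move=> x y; apply: completion_ext => n; rewrite /= raddfB. Qed.

Fact to_completion_is_monoid_morphism : monoid_morphism to_completion.
Proof.
by split=> [|x y]; apply: completion_ext => n //=; rewrite rmorphM.
Qed.

HB.instance Definition _ := GRing.isZmodMorphism.Build R completion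
  to_completion to_completion_is_zmod_morphism.
HB.instance Definition _ := GRing.isMonoidMorphism.Build R completion
  to_completion to_completion_is_monoid_morphism.

End Completion.

(* The tensor product P (x)_R S, where S is an R-algebra through phi: the free
   abelian group on P * S modulo the bilinearity relations, with S acting on
   the second factor. *)
Section TensorProduct.
Context {R S : comPzRingType} (phi : {rmorphism R -> S}) (P : lmodType R).

Let V := {freeg (P * S)%type / int}.
Let gen (p : P) (s : S) : V := << (p, s) >>.

Inductive tensor_rel : V -> Prop :=
| tensor_rel0 : tensor_rel 0
| tensor_relB x y : tensor_rel x -> tensor_rel y -> tensor_rel (x - y)
| tensor_rel_addl p q s : tensor_rel (gen (p + q) s - (gen p s + gen q s))
| tensor_rel_addr p s t : tensor_rel (gen p (s + t) - (gen p s + gen p t))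
| tensor_rel_bal r p s : tensor_rel (gen (r *: p) s - gen p (phi r * s)).

Definition tensor_pred : {pred V} := fun x => `[< tensor_rel x >].

Fact tensor_pred_zmod_closed : zmod_closed tensor_pred.
Proof.
split; first by apply/asboolP; exact: tensor_rel0.
by move=> x y /asboolP ? /asboolP ?; apply/asboolP; exact: tensor_relB.
Qed.

HB.instance Definition _ :=
  GRing.isZmodClosed.Build V tensor_pred tensor_pred_zmod_closed.

Definition tensor : Type := Quotient.quot tensor_pred.
HB.instance Definition _ := GRing.Zmodule.on tensor.

Let tpi (x : V) : tensor := \pi_(Quotient.quot tensor_pred) x.

Definition pure_tensor (p : P) (s : S) : tensor := tpi (gen p s).

Let scaleV (s : S) : V -> V := fglift (fun k : P * S => gen k.1 (s * k.2)).

Definition tensor_scale (s : S) (u : tensor) : tensor := tpi (scaleV s (repr u)).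

Let tpiB x y : tpi (x - y) = tpi x - tpi y. Proof. exact: raddfB. Qed.
Let tpi0 : tpi 0 = 0. Proof. exact: raddf0. Qed.
Let tpiD x y : tpi (x + y) = tpi x + tpi y. Proof. exact: raddfD. Qed.

Let tpi_eq x y : tpi x = tpi y <-> tensor_rel (x - y).
Proof.
split=> [/eqP|rxy]; last apply/eqP.
  by rewrite /tpi -Quotient.idealrBE => /asboolP.
by rewrite /tpi -Quotient.idealrBE; apply/asboolP.
Qed.

Let tpi_surj (u : tensor) : exists x, tpi x = u.
Proof. by exists (repr u); exact: reprK. Qed.

Let scaleVB s x y : scaleV s (x - y) = scaleV s x - scaleV s y.
Proof. exact: lift_is_additive. Qed.
Let scaleV0 s : scaleV s 0 = 0.
Proof. by rewrite -[X in scaleV s X](subrr 0) scaleVB subrr. Qed.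
Let scaleVN s x : scaleV s (- x) = - scaleV s x.
Proof. by rewrite -sub0r scaleVB scaleV0 sub0r. Qed.
Let scaleVD s x y : scaleV s (x + y) = scaleV s x + scaleV s y.
Proof. by rewrite -[y]opprK scaleVB scaleVN !opprK. Qed.
Let scaleV_gen s p t : scaleV s (gen p t) = gen p (s * t).
Proof. by rewrite /scaleV liftU scale1r. Qed.

Let scaleV_rel s x : tensor_rel x -> tensor_rel (scaleV s x).
Proof.
elim=> [|a b _ ra _ rb|p q t|p t t'|r p t].
- by rewrite scaleV0; exact: tensor_rel0.
- by rewrite scaleVB; exact: tensor_relB.
- by rewrite scaleVB scaleVD !scaleV_gen; exact: tensor_rel_addl.
- by rewrite scaleVB scaleVD !scaleV_gen mulrDr; exact: tensor_rel_addr.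
- by rewrite scaleVB !scaleV_gen mulrCA; exact: tensor_rel_bal.
Qed.

Let scale_tpi s x : tensor_scale s (tpi x) = tpi (scaleV s x).
Proof.
apply/tpi_eq; rewrite -scaleVB; apply: scaleV_rel; apply/tpi_eq.
exact: reprK.
Qed.

Lemma tensor_scale_pure s p t :
  tensor_scale s (pure_tensor p t) = pure_tensor p (s * t).
Proof. by rewrite /pure_tensor scale_tpi scaleV_gen. Qed.

Fact tensor_scaleDr : right_distributive tensor_scale +%R.
Proof.
move=> s u v; have [[x <-] [y <-]] := (tpi_surj u, tpi_surj v).
by rewrite -tpiD !scale_tpi scaleVD tpiD.
Qed.

Lemma pure_tensorDl p q s :
  pure_tensor (p + q) s = pure_tensor p s + pure_tensor q s.
Proof. by rewrite /pure_tensor -tpiD; apply/tpi_eq; exact: tensor_rel_addl. Qed.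

Lemma pure_tensorDr p s t :
  pure_tensor p (s + t) = pure_tensor p s + pure_tensor p t.
Proof. by rewrite /pure_tensor -tpiD; apply/tpi_eq; exact: tensor_rel_addr. Qed.

Lemma pure_tensor_bal r p s : pure_tensor (r *: p) s = pure_tensor p (phi r * s).
Proof. by rewrite /pure_tensor; apply/tpi_eq; exact: tensor_rel_bal. Qed.

Lemma tensor_ind (K : tensor -> Prop) :
    K 0 -> (forall u v, K u -> K v -> K (u - v)) ->
  (forall p s, K (pure_tensor p s)) -> forall u, K u.
Proof.
move=> K0 KB Kg u; have [x <-] := tpi_surj u.
have KN v : K v -> K (- v) by rewrite -sub0r; apply: (KB).
have KD v w : K v -> K w -> K (v + w).
  by move=> Kv Kw; rewrite -[w]opprK; apply: (KB) => //; apply: (KN).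
rewrite -[x]freeg_sumE; elim: (dom x) => [|k l IH]; first by rewrite big_nil tpi0.
rewrite big_cons tpiD; apply: (KD) => //.
rewrite -[coeff k x]intz -freegU_mulz; case: k => p s.
have Kn n : K (tpi ((<<(p, s)>> : V) *+ n)).
  elim: n => [|n IHn]; first by rewrite mulr0n tpi0.
  by rewrite mulrS tpiD; apply: (KD) => //; apply: (Kg).
case: (coeff _ x) => n; first exact: Kn.
by rewrite NegzE mulrNz -[- _]sub0r tpiB tpi0; apply: KB => //; apply: Kn.
Qed.

Let tensor_scale0 s : tensor_scale s 0 = 0.
Proof. by rewrite -tpi0 scale_tpi scaleV0. Qed.

Let tensor_scaleB s u v :
  tensor_scale s (u - v) = tensor_scale s u - tensor_scale s v.
Proof.
have [[x <-] [y <-]] := (tpi_surj u, tpi_surj v).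
by rewrite -tpiB !scale_tpi scaleVB tpiB.
Qed.

Fact tensor_scaleA s t u :
  tensor_scale s (tensor_scale t u) = tensor_scale (s * t) u.
Proof.
elim/tensor_ind: u => [|u v Eu Ev|p a]; first by rewrite !tensor_scale0.
  by rewrite !tensor_scaleB Eu Ev.
by rewrite !tensor_scale_pure mulrA.
Qed.

Fact tensor_scale1 : left_id 1 tensor_scale.
Proof.
elim/tensor_ind => [|u v Eu Ev|p a]; first by rewrite !tensor_scale0.
  by rewrite tensor_scaleB Eu Ev.
by rewrite tensor_scale_pure mul1r.
Qed.

Fact tensor_scaleDl u : {morph tensor_scale^~ u : s t / s + t}.
Proof.
move=> s t /=; elim/tensor_ind: u => [|u v Eu Ev|p a].
- by rewrite !tensor_scale0 addr0.
- by rewrite !tensor_scaleB Eu Ev addrACA opprD.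
- by rewrite !tensor_scale_pure mulrDl pure_tensorDr.
Qed.

HB.instance Definition _ := GRing.Zmodule_isLmodule.Build S tensor
  tensor_scaleA tensor_scale1 tensor_scaleDr tensor_scaleDl.

End TensorProduct.

Section DirectSum.
Context {R : pzRingType} (I : Type) (F : I -> lmodType R).

Definition finite_support (f : forall i, F i) : Prop :=
  finite_set [set i | f i <> 0].

Record direct_sum := DirectSum {
  direct_sum_fun :> forall i, F i;
  direct_sumP : finite_support direct_sum_fun }.

HB.instance Definition _ := gen_eqMixin direct_sum.
HB.instance Definition _ := gen_choiceMixin direct_sum.

Lemma direct_sum_ext (f g : direct_sum) : (forall i, f i = g i) -> f = g.
Proof.
case: f g => [f hf] [g hg] /= fg.
have E : f = g by apply: functional_extensionality_dep.
by subst g; congr DirectSum; exact: Prop_irrelevance.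
Qed.

Fact finite_support0 : finite_support (fun=> 0).
Proof. by apply: (sub_finite_set _ (finite_set0 I)) => i /(_ erefl). Qed.

Fact finite_support_opp (f : direct_sum) : finite_support (fun i => - f i).
Proof.
apply: sub_finite_set (direct_sumP f) => i /= nz fi0.
by apply: nz; rewrite fi0 oppr0.
Qed.

Fact finite_support_add (f g : direct_sum) : finite_support (fun i => f i + g i).
Proof.
have : finite_set ([set i | f i <> 0] `|` [set i | g i <> 0]).
  by rewrite finite_setU; split; exact: direct_sumP.
apply: sub_finite_set => i /= nz.
have [fi0|] := pselect (f i = 0); last by left.
by right=> gi0; apply: nz; rewrite fi0 gi0 addr0.
Qed.

Fact finite_support_scale a (f : direct_sum) : finite_support (fun i => a *: f i).
Proof.
apply: sub_finite_set (direct_sumP f) => i /= nz fi0.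
by apply: nz; rewrite fi0 scaler0.
Qed.

Let zero := DirectSum finite_support0.
Let add f g := DirectSum (finite_support_add f g).
Let opp f := DirectSum (finite_support_opp f).
Let scale a f := DirectSum (finite_support_scale a f).

Fact direct_sum_addA : associative add.
Proof. by move=> f g h; apply: direct_sum_ext => i; exact: addrA. Qed.
Fact direct_sum_addC : commutative add.
Proof. by move=> f g; apply: direct_sum_ext => i; exact: addrC. Qed.
Fact direct_sum_add0 : left_id zero add.
Proof. by move=> f; apply: direct_sum_ext => i; exact: add0r. Qed.
Fact direct_sum_addN : left_inverse zero opp add.
Proof. by move=> f; apply: direct_sum_ext => i; exact: addNr. Qed.

HB.instance Definition _ := GRing.isZmodule.Build direct_sum
  direct_sum_addA direct_sum_addC direct_sum_add0 direct_sum_addN.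

Fact direct_sum_scaleA a b f : scale a (scale b f) = scale (a * b) f.
Proof. by apply: direct_sum_ext => i; exact: scalerA. Qed.
Fact direct_sum_scale1 : left_id 1 scale.
Proof. by move=> f; apply: direct_sum_ext => i; exact: scale1r. Qed.
Fact direct_sum_scaleDr : right_distributive scale +%R.
Proof. by move=> a f g; apply: direct_sum_ext => i; exact: scalerDr. Qed.
Fact direct_sum_scaleDl f : {morph scale^~ f : a b / a + b}.
Proof. by move=> a b; apply: direct_sum_ext => i; exact: scalerDl. Qed.

HB.instance Definition _ := GRing.Zmodule_isLmodule.Build R direct_sum
  direct_sum_scaleA direct_sum_scale1 direct_sum_scaleDr direct_sum_scaleDl.

End DirectSum.

Section PureProjective.
Context {R : pzRingType}.

(* there is an exact sequence R^k -> R^n -> M -> 0 *)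
Definition finitely_presented (M : lmodType R) : Prop :=
  exists (n k : nat) (g : {linear 'rV[R]_n -> M})
         (f : {linear 'rV[R]_k -> 'rV[R]_n}),
    (forall y, exists x, g x = y) /\
    (forall x, g x = 0 <-> exists z, f z = x).

Definition isom_direct_summand (M D : lmodType R) : Prop :=
  exists (Q : lmodType R) (h : {linear (M * Q)%type -> D}), bijective h.

Definition pure_projective (M : lmodType R) : Prop :=
  exists (I : Type) (F : I -> lmodType R),
    (forall i, finitely_presented (F i)) /\
    isom_direct_summand M (direct_sum F).

End PureProjective.

(* Main.v *)
From HB Require Import structures.
Require Import Defs.
From mathcomp Require Import all_boot all_algebra.
From mathcomp Require Import boolp classical_sets functions cardinality fsbigop.
From mathcomp.multinomials Require Import freeg.

(** Write S for the completion of R, T for the S-module P (x) S, and tau for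
    the map p |-> p (x) 1 from P to T.

    That P (x) S is pure-projective when P is holds for every ring morphism
    R -> S: base change preserves finite presentations, direct sums and
    retracts ([tensor_pure_projective]).

    The converse holds for every pure morphism R -> S, that is, one for which
    every finite linear system over R that is solvable over S is already
    solvable over R ([pure_projective_descent]).  Over a noetherian local ring
    the completion is pure: a solution over S gives a solution modulo every
    power of the maximal ideal, and Krull's intersection theorem for finitely
    generated modules turns these into an exact solution ([completion_pure]).

    Let T be a retract of a direct sum D of finitely presented S-modules F_i,
    through iota : T -> D and rho : D -> T.  Every module is a pure quotient of
    a direct sum of finitely presented ones ([pure_presentation]), so let
    f : G -> P be such a pure epimorphism; it suffices to split it.  A partial
    section of f is recorded by its image: a submodule X of G on which f is
    injective.  Zorn's lemma applies to the partial sections such that f(X) is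
    pure in P and such that, for some set J of indices, the S-span of tau(f(X))
    is rho(D_J), where D_J is the sum of the F_i with i in J.  A maximal one is
    defined on all of P, because of the following two facts about such a
    submodule K = f(X).

    - P / K is a Mittag-Leffler module: the type of every tuple b, that is the
      set of all positive primitive formulas it satisfies, is generated by a
      single formula ([type_generated], stated for P modulo K).  Over S this
      holds for D modulo D_J, because a tuple of D only meets finitely many
      summands F_i and in a finitely presented module it is immediate; it passes
      to the retract T modulo the span of tau(K).  To come down to R, the
      finitely many equations that witness the generating formula in T are
      traced back, by the equational criterion [tensor_vanish], to finitely many
      equations in P modulo K; implications between formulas are linear systems
      of matrix equations, hence descend by purity ([type_generated_descent]).

    - Over such a K the partial section can be extended to a submodule that is
      countably generated over K and contains any prescribed element.  Each
      finite tuple of a Mittag-Leffler module extends to a countable sequence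
      whose span is pure; lifting the sequence along f step by step, while keeping a
      generator of the type satisfied in G, gives a well-defined extension of
      the section.  The sequence can moreover be closed under any operation with
      finite lists as values ([countable_extension]), which is used to keep the
      span of tau equal to some rho(D_J').  *)

Set Implicit Arguments.
Unset Strict Implicit.
Unset Printing Implicit Defensive.

Import GRing.Theory.
Local Open Scope ring_scope.

(** * Tuples of elements and matrices *)

Section Submodules.
Context {R : pzRingType} {M : lmodType R}.

Definition submod (K : M -> Prop) : Prop :=
  [/\ K 0, forall x y, K x -> K y -> K (x + y) & forall a x, K x -> K (a *: x)].

Lemma submodN K x : submod K -> K x -> K (- x).
Proof. by case=> _ _ KZ Kx; rewrite -scaleN1r; apply: KZ. Qed.

Lemma submodB K x y : submod K -> K x -> K y -> K (x - y).
Proof. by move=> sK Kx Ky; case: (sK) => _ KD _; apply: KD => //; apply: submodN. Qed.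

Lemma submod_sum K (I : Type) (s : seq I) (F : I -> M) :
  submod K -> (forall i, K (F i)) -> K (\sum_(i <- s) F i).
Proof.
case=> K0 KD _ KF; elim: s => [|i s IH]; first by rewrite big_nil.
by rewrite big_cons; apply: KD.
Qed.

Lemma submod0 : submod (fun x => x = 0).
Proof.
by split=> // [x y -> ->|a x ->]; rewrite ?addr0 ?scaler0.
Qed.

End Submodules.

Section MatrixAction.
Context {R : pzRingType} {M : lmodType R}.

(** A tuple of elements of [M] is a column over [M], so that tuples inherit the
    addition and the block operations of matrices. *)
Definition act m n p (A : 'M[R]_(m, n)) (x : 'M[M]_(n, p)) : 'M[M]_(m, p) :=
  \matrix_(i, j) \sum_k A i k *: x k j.

Local Notation "A *v x" := (act A x) (at level 40, left associativity).

Lemma actA m n p q (A : 'M_(m, n)) (B : 'M_(n, p)) (x : 'M[M]_(p, q)) :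
  A *v (B *v x) = (A *m B) *v x.
Proof.
apply/matrixP => i j; rewrite !mxE.
under eq_bigr => k _ do rewrite mxE scaler_sumr.
rewrite exchange_big; apply: eq_bigr => l _.
by rewrite mxE scaler_suml; apply: eq_bigr => k _; rewrite scalerA.
Qed.

Lemma actDl m n p (A B : 'M_(m, n)) (x : 'M[M]_(n, p)) :
  (A + B) *v x = A *v x + B *v x.
Proof.
apply/matrixP => i j; rewrite !mxE -big_split; apply: eq_bigr => k _.
by rewrite mxE scalerDl.
Qed.

Lemma actNl m n p (A : 'M_(m, n)) (x : 'M[M]_(n, p)) : (- A) *v x = - (A *v x).
Proof.
apply/matrixP => i j; rewrite !mxE -sumrN; apply: eq_bigr => k _.
by rewrite mxE scaleNr.
Qed.

Lemma actBl m n p (A B : 'M_(m, n)) (x : 'M[M]_(n, p)) :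
  (A - B) *v x = A *v x - B *v x.
Proof. by rewrite actDl actNl. Qed.

Lemma actDr m n p (A : 'M_(m, n)) (x y : 'M[M]_(n, p)) :
  A *v (x + y) = A *v x + A *v y.
Proof.
apply/matrixP => i j; rewrite !mxE -big_split; apply: eq_bigr => k _.
by rewrite mxE scalerDr.
Qed.

Lemma actNr m n p (A : 'M_(m, n)) (x : 'M[M]_(n, p)) : A *v (- x) = - (A *v x).
Proof.
apply/matrixP => i j; rewrite !mxE -sumrN; apply: eq_bigr => k _.
by rewrite mxE scalerN.
Qed.

Lemma actBr m n p (A : 'M_(m, n)) (x y : 'M[M]_(n, p)) :
  A *v (x - y) = A *v x - A *v y.
Proof. by rewrite actDr actNr. Qed.

Lemma act0l m n p (x : 'M[M]_(n, p)) : (0 : 'M_(m, n)) *v x = 0.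
Proof. by rewrite -[X in X *v _](subrr 0) actBl subrr. Qed.

Lemma act0r m n p (A : 'M_(m, n)) : A *v (0 : 'M[M]_(n, p)) = 0.
Proof. by rewrite -[X in _ *v X](subrr 0) actBr subrr. Qed.

Lemma actZl_entry m n p a (A : 'M_(m, n)) (x : 'M[M]_(n, p)) i j :
  ((a *: A) *v x) i j = a *: (A *v x) i j.
Proof.
by rewrite !mxE scaler_sumr; apply: eq_bigr => k _; rewrite mxE scalerA.
Qed.

Lemma act1 n p (x : 'M[M]_(n, p)) : 1%:M *v x = x.
Proof.
apply/matrixP => i j; rewrite mxE (bigD1 i) //= mxE eqxx scale1r big1 ?addr0 //.
by move=> k /negPf ki; rewrite mxE eq_sym ki scale0r.
Qed.

Lemma act_row_col m n1 n2 p (A : 'M_(m, n1)) (B : 'M_(m, n2))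
  (x : 'M[M]_(n1, p)) (y : 'M[M]_(n2, p)) :
  row_mx A B *v col_mx x y = A *v x + B *v y.
Proof.
apply/matrixP => i j; rewrite !mxE big_split_ord /=; congr (_ + _);
  by apply: eq_bigr => k _; rewrite ?row_mxEl ?row_mxEr ?col_mxEu ?col_mxEd.
Qed.

Lemma act_col m1 m2 n p (A : 'M_(m1, n)) (B : 'M_(m2, n)) (x : 'M[M]_(n, p)) :
  col_mx A B *v x = col_mx (A *v x) (B *v x).
Proof.
apply/matrixP => i j; rewrite -[i]splitK /unsplit; case: (fintype.split i) => k /=.
  by rewrite col_mxEu !mxE; apply: eq_bigr => l _; rewrite col_mxEu.
by rewrite col_mxEd !mxE; apply: eq_bigr => l _; rewrite col_mxEd.
Qed.

Lemma act_block m1 m2 n1 n2 p (A : 'M_(m1, n1)) (B : 'M_(m1, n2))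
  (C : 'M_(m2, n1)) (D : 'M_(m2, n2)) (x : 'M[M]_(n1, p)) (y : 'M[M]_(n2, p)) :
  block_mx A B C D *v col_mx x y = col_mx (A *v x + B *v y) (C *v x + D *v y).
Proof. by rewrite /block_mx act_col !act_row_col. Qed.

Definition allin (K : M -> Prop) m n (x : 'M[M]_(m, n)) : Prop :=
  forall i j, K (x i j).

Lemma allin_act K m n p (A : 'M_(m, n)) (x : 'M[M]_(n, p)) :
  submod K -> allin K x -> allin K (A *v x).
Proof.
move=> sK Kx i j; rewrite mxE; apply: submod_sum => // k.
by case: sK => _ _; apply.
Qed.

Lemma allinD K m n (x y : 'M[M]_(m, n)) :
  submod K -> allin K x -> allin K y -> allin K (x + y).
Proof. by case=> _ KD _ Kx Ky i j; rewrite mxE; apply: KD. Qed.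

Lemma allinN K m n (x : 'M[M]_(m, n)) : submod K -> allin K x -> allin K (- x).
Proof. by move=> sK Kx i j; rewrite mxE; apply: submodN. Qed.

Lemma allinB K m n (x y : 'M[M]_(m, n)) :
  submod K -> allin K x -> allin K y -> allin K (x - y).
Proof. by move=> sK Kx Ky; apply: allinD => //; apply: allinN. Qed.

Lemma allin0 K m n : submod K -> allin K (0 : 'M[M]_(m, n)).
Proof. by case=> K0 _ _ i j; rewrite mxE. Qed.

Lemma allin_col K m1 m2 n (x : 'M[M]_(m1, n)) (y : 'M[M]_(m2, n)) :
  allin K (col_mx x y) <-> allin K x /\ allin K y.
Proof.
split=> [Kxy|[Kx Ky] i j].
  split=> i j; first by have := Kxy (lshift _ i) j; rewrite col_mxEu.
  by have := Kxy (rshift _ i) j; rewrite col_mxEd.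
rewrite -[i]splitK /unsplit; case: (fintype.split i) => k /=.
  by rewrite col_mxEu.
by rewrite col_mxEd.
Qed.

Lemma allin_eq0 m n (x : 'M[M]_(m, n)) : allin (fun u => u = 0) x <-> x = 0.
Proof.
split=> [x0|-> i j]; last by rewrite mxE.
by apply/matrixP => i j; rewrite x0 mxE.
Qed.

End MatrixAction.

Notation "A *v x" := (act A x) (at level 40, left associativity) : ring_scope.

Lemma map_act (R : pzRingType) (M M' : lmodType R) (f : {linear M -> M'}) m n p
  (A : 'M[R]_(m, n)) (x : 'M[M]_(n, p)) : map_mx f (A *v x) = A *v map_mx f x.
Proof.
apply/matrixP => i j; rewrite !mxE raddf_sum; apply: eq_bigr => k _.
by rewrite mxE; exact: linearZ.
Qed.

Lemma mx0rows (T : Type) n (A B : 'M[T]_(0, n)) : A = B.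
Proof. by apply/matrixP => -[]. Qed.

Lemma mx0cols (T : Type) m (A B : 'M[T]_(m, 0)) : A = B.
Proof. by apply/matrixP => i []. Qed.

Lemma tuple_choice (T U : Type) m n (x : 'M[T]_(m, n)) (Q : T -> U -> Prop) :
  (forall i j, exists u, Q (x i j) u) ->
  exists y : 'M[U]_(m, n), forall i j, Q (x i j) (y i j).
Proof.
move=> h; have {}h (k : 'I_m * 'I_n) : exists u, Q (x k.1 k.2) u by apply: h.
have [f fP] := choice h; exists (\matrix_(i, j) f (i, j)) => i j.
by rewrite mxE; exact: (fP (i, j)).
Qed.

(** * Noetherian modules and Krull's intersection theorem *)

Section NoetherianModules.
Context {R : comPzRingType}.

(** Generation by a list is expressed by the submodules containing the list,
    which avoids naming coefficients. *)
Definition noetherian_module (M : lmodType R) : Prop :=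
  forall K : M -> Prop, submod K ->
    exists2 l : seq M, (forall x, x \in l -> K x) &
      forall K', submod K' -> (forall x, x \in l -> K' x) -> forall x, K x -> K' x.

(** Otherwise the family contains a strictly increasing sequence; the list that
    generates the union of the sequence is already contained in a term. *)
Lemma noetherian_max (M : lmodType R) (F : (M -> Prop) -> Prop) :
  noetherian_module M -> (forall K, F K -> submod K) -> forall K0, F K0 ->
  exists2 K, F K & forall K', F K' -> (forall x, K x -> K' x) ->
    forall x, K' x -> K x.
Proof.
move=> noethM sF K0 FK0; apply: contrapT => nomax.
have next (K : {K | F K}) : exists K' : {K | F K},
    (forall x, sval K x -> sval K' x) /\ ~ (forall x, sval K' x -> sval K x).
  apply: contrapT => noK; apply: nomax; exists (sval K); first exact: svalP.
  move=> K' FK' KK' x K'x; apply: contrapT => nKx; apply: noK.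
  by exists (exist _ K' FK') => /=; split=> // /(_ x K'x).
have [f fP] := choice next.
pose K := fix K n := if n is k.+1 then f (K k) else exist _ K0 FK0.
have Kle i j : (i <= j)%N -> forall x, sval (K i) x -> sval (K j) x.
  move=> /subnKC <-; elim: (j - i)%N => [|d IH] x; first by rewrite addn0.
  by rewrite addnS => /IH; apply: (fP (K (i + d)%N)).1.
have sK n : submod (sval (K n)) by apply: sF; exact: svalP.
pose U x := exists n, sval (K n) x.
have sU : submod U.
  split=> [|x y [i Kx] [j Ky]|a x [i Kx]].
  - by exists 0%N; case: (sK 0%N).
  - exists (maxn i j); case: (sK (maxn i j)) => _ KD _.
    by apply: KD; [apply: Kle Kx; exact: leq_maxl | apply: Kle Ky; exact: leq_maxr].
  - by exists i; case: (sK i) => _ _; apply.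
have [l lU Ul] := noethM U sU.
have [n ln] : exists n, forall x, x \in l -> sval (K n) x.
  elim: l lU {Ul} => [|y l IH] lU; first by exists 0%N.
  have [n ln] := IH (fun x xl => lU x (mem_behead (s := y :: l) xl)).
  have [k Ky] := lU y (mem_head _ _).
  exists (maxn n k) => x; rewrite inE => /predU1P[->|xl].
    by apply: Kle Ky; exact: leq_maxr.
  by apply: Kle (ln x xl); exact: leq_maxl.
apply: (fP (K n)).2 => x Kx; apply: (Ul _ (sK n) ln).
by exists n.+1.
Qed.

(** By induction on [n]: a submodule is generated by lifts of generators of the
    ideal of its first coordinates, together with generators of its elements
    with vanishing first coordinate. *)
Lemma noetherian_rV (n : nat) : noetherian R -> noetherian_module 'rV[R]_n.
Proof.
move=> noethR; elim: n => [|n IH] K sK.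
  exists [::] => // K' sK' _ x _.
  by rewrite (mx0cols x 0); case: sK'.
have [K0 KD KZ] := sK.
have I_ideal : is_ideal (fun a => exists2 v : 'rV[R]_(1 + n), K v & v 0 0 = a).
  split=> [|_ _ [v Kv <-] [w Kw <-]|a _ [v Kv <-]].
  - by exists 0 => //; rewrite mxE.
  - by exists (v + w); rewrite ?mxE //; apply: KD.
  - by exists (a *: v); rewrite ?mxE //; apply: KZ.
have [k [g gP]] := noethR (Ideal I_ideal).
have vP j : exists v : 'rV[R]_(1 + n), K v /\ v 0 0 = g j.
  have /gP [v Kv vg] : exists c : 'I_k -> R, g j = \sum_i c i * g i.
    exists (fun i => (i == j)%:R); rewrite (bigD1 j) //= eqxx mul1r big1 ?addr0 //.
    by move=> i /negPf ->; rewrite mul0r.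
  by exists v.
have [v {}vP] := choice vP.
pose K1 (w : 'rV[R]_n) := K (row_mx 0 w : 'rV_(1 + n)).
have row0Z a (w : 'rV[R]_n) : row_mx 0 (a *: w) = a *: (row_mx 0 w : 'rV_(1 + n)).
  by rewrite scale_row_mx scaler0.
have row0D (w w' : 'rV[R]_n) :
    row_mx 0 (w + w') = row_mx 0 w + row_mx 0 w' :> 'rV_(1 + n).
  by rewrite add_row_mx addr0.
have sub1 H : submod H -> submod (fun w : 'rV[R]_n => H (row_mx 0 w : 'rV_(1 + n))).
  case=> H0 HD HZ; split=> [|x y Hx Hy|a x Hx]; first by rewrite row_mx0.
    by rewrite row0D; apply: HD.
  by rewrite row0Z; apply: HZ.
have [l lK1 K1l] := IH K1 (sub1 K sK).
exists ([seq v j | j <- enum 'I_k] ++ [seq (row_mx 0 w : 'rV_(1 + n)) | w <- l]).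
  move=> x; rewrite mem_cat => /orP[] /mapP[y yl ->]; first by case: (vP y).
  exact: lK1.
move=> K' sK' lK' x Kx.
have [c xc] : exists c : 'I_k -> R, x 0 0 = \sum_i c i * g i.
  by apply/gP; exists x.
pose y : 'rV[R]_(1 + n) := \sum_i c i *: v i.
have vK' i : K' (v i).
  by apply: lK'; rewrite mem_cat map_f // mem_enum.
have sy H : submod H -> (forall i, H (v i)) -> H y.
  move=> sH vH; apply: submod_sum => // i.
  by case: sH => _ _; apply.
have [w xyE] : exists w, x - y = row_mx (0 : 'M_(1, 1)) w.
  exists (rsubmx (x - y : 'rV_(1 + n))).
  have <- : lsubmx (x - y : 'rV_(1 + n)) = 0; last by rewrite hsubmxK.
  apply/matrixP => i j; rewrite !ord1 !mxE.
  rewrite (_ : lshift n 0 = 0); last exact/val_inj.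
  rewrite xc summxE; apply/eqP; rewrite subr_eq0; apply/eqP.
  by apply: eq_bigr => q _; rewrite mxE (vP q).2.
rewrite -(subrK y x); case: (sK') => _ K'D _; apply: (K'D); last exact: sy.
rewrite xyE; apply: (K1l _ (sub1 _ sK')) => [w' wl|].
  by apply: lK'; rewrite mem_cat map_f ?orbT.
rewrite /K1 -xyE; apply: submodB => //; apply: sy => // i.
by case: (vP i).
Qed.

Lemma noetherian_surj (M M' : lmodType R) (f : {linear M -> M'}) :
  (forall y, exists x, f x = y) -> noetherian_module M -> noetherian_module M'.
Proof.
move=> surjf noethM K sK.
have pre H : submod H -> submod (fun x => H (f x)).
  case=> H0 HD HZ; split=> [|x y Hx Hy|a x Hx].
  - by rewrite linear0.
  - by rewrite linearD; apply: HD.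
  - by rewrite linearZ; apply: HZ.
have [l lK Kl] := noethM _ (pre K sK).
exists (map f l) => [y /mapP[x xl ->]|K' sK' lK' y]; first exact: lK.
have [x <-] := surjf y => Kfx; apply: (Kl _ (pre _ sK')) => // z zl.
by apply: lK'; exact: map_f.
Qed.

Lemma noetherian_mx (n k : nat) : noetherian R -> noetherian_module 'M[R]_(n, k).
Proof.
move=> noethR.
pose f : {linear 'rV[R]_(n * k) -> 'M[R]_(n, k)} := vec_mx.
apply: (@noetherian_surj _ _ f) (@noetherian_rV _ noethR) => y.
by exists (mxvec y); rewrite /= mxvecK.
Qed.

Lemma submod_extend (M : lmodType R) (K : M -> Prop) (v : M) :
  submod K -> submod (fun x => exists a, K (x - a *: v)).
Proof.
case=> K0 KD KZ; split=> [|x y [a Kx] [b Ky]|c x [a Kx]].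
- by exists 0; rewrite scale0r subr0.
- by exists (a + b); rewrite scalerDl opprD addrACA; apply: KD.
- by exists (c * a); rewrite -scalerA -scalerBr; apply: KZ.
Qed.

Lemma noetherian_regular : noetherian R -> noetherian_module R^o.
Proof.
move=> noethR K [K0 KD KZ].
have I_ideal : @is_ideal R K by split.
have [k [g gP]] := noethR (Ideal I_ideal).
exists [seq g i | i <- enum 'I_k].
  move=> _ /mapP[i _ ->]; apply/(gP (g i)); exists (fun j => (j == i)%:R).
  rewrite (bigD1 i) //= eqxx mul1r big1 ?addr0 //.
  by move=> j /negPf ->; rewrite mul0r.
move=> K' sK' gK' x /gP[c ->]; apply: (submod_sum _ sK') => i.
by case: (sK') => _ _ K'Z; apply: (K'Z); apply: gK'; rewrite map_f ?mem_enum.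
Qed.

Section LocalRing.
Variables (m : ideal R) (noethR : noetherian R) (localR : local_ring m).

(** A maximal proper ideal containing [1 - a] would be [m], which would then
    contain [1]. *)
Lemma local_unit a : m a -> exists b, b * (1 - a) = 1.
Proof.
move=> ma; apply: contrapT => nounit.
pose F (K : R^o -> Prop) := [/\ submod K, ~ K 1 & K (1 - a)].
have F0 : F (fun x => exists b, x = b * (1 - a)).
  split=> [|[b b1]|]; last by exists 1; rewrite mul1r.
    split=> [|_ _ [b ->] [c ->]|c _ [b ->]].
    - by exists 0; rewrite mul0r.
    - by exists (b + c); rewrite mulrDl.
    - by exists (c * b); rewrite -mulrA.
  by apply: nounit; exists b.
have sF K : F K -> submod K by case.
have [K [sK nK1 Ka] Kmax] := noetherian_max (noetherian_regular noethR) sF F0.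
have K_ideal : @is_ideal R K by case: sK.
have Kmaximal : maximal_ideal (Ideal K_ideal).
  split=> // J KJ nJ1 x; apply: (Kmax J) => //; split=> //; last exact: KJ.
  by case: (idealP J).
have [[nm1 _] uniq_m] := localR; have [_ mD _] := idealP m.
apply: nm1; rewrite -(subrK a 1); apply: mD => //.
by rewrite -(uniq_m _ Kmaximal).
Qed.

Lemma ideal_powD (I : ideal R) k l x (H : R -> Prop) :
  is_ideal H ->
  (forall u v, ideal_pow I k u -> ideal_pow I l v -> H (u * v)) ->
  ideal_pow I (k + l) x -> H x.
Proof.
elim: k x H => [|k IH] x H Hid Huv; first by move=> Ix; rewrite -[x]mul1r; apply: Huv.
have [H0 HD HM] := Hid; case=> [q [a [b [Ia Ib ->]]]].
elim/big_ind: _ => [//|//|i _]; apply: (IH _ (fun y => H (a i * y))) (Ib i).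
  split=> [|y z Hy Hz|c y Hy]; first by rewrite mulr0.
    by rewrite mulrDr; apply: HD.
  by rewrite mulrCA; apply: HM.
move=> u v Iu Iv; rewrite mulrA; apply: Huv => //.
by exists 1%N, (fun=> a i), (fun=> u); split=> //; rewrite big_ord1.
Qed.

(** Let [K] be maximal among the ideals that contain [J] but no power of [I].
    If [a] is in [I] and not in [K], then both [K + (a)] and [K : a] are strictly
    larger than [K], so they contain powers of [I], whose product lies in [K]. *)
Lemma ideal_pow_sub (I J : ideal R) :
  (forall a, I a -> exists t, J (a ^+ t)) -> exists k, forall x, ideal_pow I k x -> J x.
Proof.
move=> rad; apply: contrapT => nopow.
pose F (K : R^o -> Prop) := [/\ submod K, forall x, J x -> K x &
  ~ exists k, forall x, ideal_pow I k x -> K x].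
have FJ : F (J : R -> Prop) by split=> //; case: (idealP J).
have sF K : F K -> submod K by case.
have [K [sK JK nK] Kmax] := noetherian_max (noetherian_regular noethR) sF FJ.
have [K0 KD KZ] := sK.
have pow_of K' : submod K' -> (forall x, K x -> K' x) -> (exists2 x, K' x & ~ K x) ->
    exists k, forall x, ideal_pow I k x -> K' x.
  move=> sK' KK' [y K'y nKy]; apply: contrapT => nK'; apply: nKy.
  by apply: (Kmax K') => //; split=> // z /JK /KK'.
have [a Ia nKa] : exists2 a, I a & ~ K a.
  apply: contrapT => IK; apply: nK; exists 1%N => _ [n [a [b [aI _ ->]]]].
  apply: (submod_sum _ sK) => i; rewrite mulrC; apply: (KZ (b i)).
  by apply: contrapT => nKa; apply: IK; exists (a i).
have [k kP] : exists k, forall x, ideal_pow I k x -> exists c, K (x - c * a).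
  apply: (pow_of (fun x : R^o => exists c, K (x - c * a))).
  - exact: (submod_extend (M := R^o)).
  - by move=> x Kx; exists 0; rewrite mul0r subr0.
  - by exists a => //; exists 1; rewrite mul1r subrr.
have sKa : submod (fun x : R^o => K (x * a)).
  split=> [|x y Kx Ky|c x Kx]; first by rewrite mul0r.
    by rewrite mulrDl; apply: KD.
  by rewrite -[c *: x]/(c * x) -mulrA; apply: KZ.
have [l lP] : exists l, forall x, ideal_pow I l x -> K (x * a).
  apply: pow_of => [//|x Kx|]; first by rewrite mulrC; apply: KZ.
  have [t /JK] := rad a Ia; elim: t => [|t IH] Kt.
    by case: nKa; rewrite -[a]mulr1; apply: (KZ a).
  have [Kt'|nKt] := pselect (K (a ^+ t)); first exact: IH.
  by exists (a ^+ t) => //; rewrite -exprSr.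
apply: nK; exists (k + l)%N => x; apply: ideal_powD => [//|u v /kP[c Kuc] /lP Kva].
rewrite -(subrK (c * a) u) mulrDl; apply: KD.
  by rewrite mulrC; apply: KZ.
by rewrite -mulrA [a * v]mulrC; apply: KZ.
Qed.

(** The hypothesis says that [x] lies in the intersection [N'] of the submodules
    [N + m ^ k M].  If [N'] were not [N], take a maximal proper submodule [L] of
    [N'] containing [N]; then [m N'] is contained in [L].  For [K] maximal among
    the submodules whose intersection with [N'] is [L], every element of [m] has
    a power that maps [M] into [K], hence so does a power of [m], and [N'] is
    contained in [K]: a contradiction. *)
Theorem krull_intersection (M : lmodType R) (N : M -> Prop) (x : M) :
  noetherian_module M -> submod N ->
  (forall k K, submod K -> (forall y, N y -> K y) ->
    (forall a v, ideal_pow m k a -> K (a *: v)) -> K x) -> N x.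
Proof.
move=> noethM sN Nx.
pose N' x := forall k K, submod K -> (forall y, N y -> K y) ->
  (forall a v, ideal_pow m k a -> K (a *: v)) -> K x.
suff N'N : forall y, N' y -> N y by apply: N'N.
have sN' : submod N'.
  split=> [k K [] //|y z N'y N'z k K sK NK mK|a y N'y k K sK NK mK].
    by case: (sK) => _ KD _; apply: KD; [apply: N'y NK mK | apply: N'z NK mK].
  by case: (sK) => _ _ KZ; apply: KZ; apply: N'y NK mK.
apply: contrapT => nN'N.
pose F (L : M -> Prop) := [/\ submod L, forall y, N y -> L y,
  forall y, L y -> N' y & ~ forall y, N' y -> L y].
have NN' y : N y -> N' y by move=> Ny k K _ NK _; apply: NK.
have sF L : F L -> submod L by case.
have [//|L [sL NL LN' nL] Lmax] := noetherian_max noethM sF (K0 := N).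
have [L0 LD LZ] := sL; have [N'0 N'D N'Z] := sN'.
(* by maximality N' / L is simple, so that the maximal ideal kills it *)
have mN'L a y : m a -> N' y -> L (a *: y).
  move=> ma N'y; have [//|nLay] := pselect (L (a *: y)); case: (nLay).
  have [c Lc] : exists c, L (y - c *: (a *: y)).
    apply: contrapT => nc; apply: nLay.
    apply: (Lmax (fun z => exists c, L (z - c *: (a *: y)))).
    - split; first exact: submod_extend.
      + by move=> z Nz; exists 0; rewrite scale0r subr0; apply: NL.
      + move=> z [c Lz]; rewrite -(subrK (c *: (a *: y)) z).
        by apply: N'D; [exact: LN' | do 2 apply: (N'Z)].
      + by move=> N'L; apply: nc; apply: N'L.
    - by move=> z Lz; exists 0; rewrite scale0r subr0.
    - by exists 1; rewrite scale1r subrr.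
  have [b b1] : exists b, b * (1 - c * a) = 1.
    by apply: local_unit; case: (idealP m) => _ _; apply.
  rewrite -[y]scale1r -b1 -scalerA; apply: (LZ a); apply: LZ.
  by rewrite scalerBl scale1r -scalerA.
pose G (K : M -> Prop) := [/\ submod K, forall y, L y -> K y &
  forall y, K y -> N' y -> L y].
have sG K : G K -> submod K by case.
have [//|K [sK LK KL] Kmax] := noetherian_max noethM sG (K0 := L).
have [K0 KD KZ] := sK.
apply: nL => y N'y; apply: (KL) => //.
have [k kP] : exists k, forall a, ideal_pow m k a -> forall v, K (a *: v).
  have sJ : is_ideal (fun a => forall v, K (a *: v)).
    split=> [v|a b Ka Kb v|a b Kb v]; first by rewrite scale0r.
      by rewrite scalerDl; apply: KD.
    by rewrite -scalerA; apply: KZ.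
  apply: (@ideal_pow_sub m (Ideal sJ)) => a ma /=.
  pose C t v := K (a ^+ t *: v).
  have sC t : submod (C t).
    split=> [|u v Cu Cv|b v Cv]; rewrite /C ?scaler0 //.
      by rewrite scalerDr; apply: KD.
    by rewrite scalerA mulrC -scalerA; apply: KZ.
  have CS t v : C t v -> C t.+1 v by rewrite /C exprS -scalerA => Cv; apply: KZ.
  (* the increasing chain of the submodules {v | a ^ t v in K} is stationary *)
  have [t Ct] : exists t, forall v, C t.+1 v -> C t v.
    pose H (X : M -> Prop) := exists t, forall v, X v <-> C t v.
    have sH X : H X -> submod X.
      by case=> t /(fun h v => propext (h v)) /funext ->.
    have H0 : H (C 0%N) by exists 0%N.
    have [X [t Xt] Xmax] := noetherian_max noethM sH H0.
    exists t => v Cv; apply/Xt; apply: (Xmax (C t.+1)) Cv; first by exists t.+1.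
    by move=> u /Xt /CS.
  (* a ^ t M can be added to K without enlarging its intersection with N' *)
  exists t => v.
  apply: (Kmax (fun z => exists w, K (z - a ^+ t *: w))).
  - split.
    + split=> [|u w [u' Ku] [w' Kw]|c u [u' Ku]].
      * by exists 0; rewrite scaler0 subr0.
      * by exists (u' + w'); rewrite scalerDr opprD addrACA; apply: KD.
      * by exists (c *: u'); rewrite scalerA mulrC -scalerA -scalerBr; apply: KZ.
    + by move=> z Lz; exists 0; rewrite scaler0 subr0; apply: LK.
    + move=> z [w Kzw] N'z; apply: (KL) => //.
      rewrite -(subrK (a ^+ t *: w) z); apply: KD => //; apply: Ct.
      rewrite /C exprS -scalerA.
      rewrite -[a ^+ t *: w](subKr z) scalerBr; apply: submodB => //; last exact: KZ.
      by apply: LK; apply: mN'L.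
  - by move=> z Kz; exists 0; rewrite scaler0 subr0.
  - by exists v; rewrite subrr.
apply: (N'y k K) => // [z /NL /LK //|a v mka].
exact: kP.
Qed.

End LocalRing.
End NoetherianModules.

(** * Purity of the completion *)

(** Every finite linear system has the form [C + B W = Y D] in the unknowns [W]
    and [Y], already with [l = 0]; this two-sided form is the one in which
    implications between systems of linear equations appear below. *)
Definition pure_morphism (R S : comPzRingType) (phi : {rmorphism R -> S}) : Prop :=
  forall p k q l (C : 'M[R]_(p, q)) (B : 'M[R]_(p, k)) (D : 'M[R]_(l, q)),
    (exists (W : 'M[S]_(k, q)) (Y : 'M[S]_(p, l)),
        map_mx phi C + map_mx phi B *m W = Y *m map_mx phi D) ->
    exists W Y, C + B *m W = Y *m D.

Section CompletionPure.
Context {R : comPzRingType} (m : ideal R).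

Definition completion_at n (u : completion m) : residue_ring (ideal_pow m n) := u n.

Fact completion_at_is_zmod_morphism n : zmod_morphism (@completion_at n).
Proof. by []. Qed.

Fact completion_at_is_monoid_morphism n : monoid_morphism (@completion_at n).
Proof. by split=> //; rewrite /completion_at /= rmorph1. Qed.

HB.instance Definition _ n := GRing.isZmodMorphism.Build
  (completion m) (residue_ring (ideal_pow m n)) (@completion_at n)
  (completion_at_is_zmod_morphism n).
HB.instance Definition _ n := GRing.isMonoidMorphism.Build
  (completion m) (residue_ring (ideal_pow m n)) (@completion_at n)
  (completion_at_is_monoid_morphism n).

(** A solution over the completion truncates to solutions modulo every power of
    [m]; these glue to a solution over [R] by Krull's intersection theorem. *)
Lemma completion_pure :
  noetherian R -> local_ring m -> pure_morphism (to_completion m).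
Proof.
move=> noethR localR p k q l C B D [W [Y E]].
pose N (X : 'M[R]_(p, q)) := exists W Y, X + B *m W = Y *m D.
have sN : submod N.
  split=> [|X X' [W1 [Y1 E1]] [W2 [Y2 E2]]|a X [W1 [Y1 E1]]].
  - by exists 0, 0; rewrite mulmx0 mul0mx addr0.
  - by exists (W1 + W2), (Y1 + Y2); rewrite mulmxDr mulmxDl addrACA E1 E2.
  - by exists (a *: W1), (a *: Y1); rewrite -scalemxAr -scalemxAl -scalerDr E1.
apply: (krull_intersection noethR localR (noetherian_mx (n := p) (k := q) noethR) sN).
move=> n K sK NK nK; have [K0 KD KZ] := sK.
have lift_mx a b (U : 'M[completion m]_(a, b)) :
    exists V : 'M[R]_(a, b), map_mx (residue (ideal_pow m n)) V = map_mx (@completion_at n) U.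
  have [V VP] : exists V : 'M[R]_(a, b), forall i j,
      residue (ideal_pow m n) (V i j) = completion_at n (U i j).
    by apply: (tuple_choice (Q := fun u v => residue (ideal_pow m n) v = completion_at n u))
      => i j; exact: residue_surj.
  by exists V; apply/matrixP => i j; rewrite !mxE VP.
have [W' EW] := lift_mx _ _ W; have [Y' EY] := lift_mx _ _ Y.
have toE a b (U : 'M[R]_(a, b)) :
    map_mx (@completion_at n) (map_mx (to_completion m) U) = map_mx (residue (ideal_pow m n)) U.
  by rewrite -map_mx_comp.
have {}E : map_mx (residue (ideal_pow m n)) (C + B *m W' - Y' *m D) = 0.
  rewrite raddfB /= map_mxD !map_mxM EW EY.
  have := congr1 (map_mx (@completion_at n)) E.
  by rewrite map_mxD !map_mxM !toE => ->; rewrite subrr.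
rewrite -[C](subrK (Y' *m D - B *m W')); apply: (KD); last first.
  by apply: NK; exists W', Y'; rewrite subrK.
rewrite opprB addrA; set X := _ - _ in E *.
rewrite [X]matrix_sum_delta; apply: (submod_sum _ sK) => i.
apply: (submod_sum _ sK) => j; apply: nK.
have /matrixP/(_ i j) := E; rewrite !mxE -(raddf0 (residue (ideal_pow m n))).
by move/residue_eq; rewrite subr0.
Qed.
End CompletionPure.

(** * Maps out of tensor products and vanishing of tensors *)

Section LinearEx.
Context {R : pzRingType} {M M' : lmodType R}.

Lemma linear_ex (f : M -> M') : linear f -> exists g : {linear M -> M'}, g =1 f.
Proof.
move=> lf; pose g := GRing.isLinear.Build R M M' *:%R f lf.
by exists (HB.pack_for {linear M -> M'} f g).
Qed.
End LinearEx.

Section TensorLift.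
Context {R S : comPzRingType} (phi : {rmorphism R -> S}) (P : lmodType R).

(** The free abelian group on the pairs maps to any abelian group, considered
    as a module over the integers. *)
Lemma formal_lift (B : zmodType) (beta : P -> S -> B) :
  exists2 F : {freeg (P * S)%type / int} -> B,
    forall x y, F (x - y) = F x - F y & forall p s, F << (p, s) >> = beta p s.
Proof.
pose beta' (k : P * S) : zmodule B := beta k.1 k.2.
exists (fglift beta') => [x y|p s]; first exact: (lift_is_additive beta').
by rewrite liftU scale1r.
Qed.

Lemma tensor_eq (x y : {freeg (P * S)%type / int}) :
  \pi_(Quotient.quot (tensor_pred phi (P := P)))%qT x
  = \pi_(Quotient.quot (tensor_pred phi (P := P)))%qT y <-> tensor_rel phi (x - y).
Proof.
split=> [/eqP|rxy]; last apply/eqP.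
  by rewrite -Quotient.idealrBE => /asboolP.
by rewrite -Quotient.idealrBE; apply/asboolP.
Qed.

Lemma tensor_lift (B : lmodType S) (beta : P -> S -> B) :
  (forall p q s, beta (p + q) s = beta p s + beta q s) ->
  (forall p s t, beta p (s + t) = beta p s + beta p t) ->
  (forall r p s, beta (r *: p) s = beta p (phi r * s)) ->
  (forall p s t, beta p (s * t) = s *: beta p t) ->
  exists f : {linear tensor phi P -> B}, forall p s, f (pure_tensor phi p s) = beta p s.
Proof.
move=> betaDl betaDr betaB betaZ.
have [F FB Fg] := formal_lift beta.
have F0 : F 0 = 0 by rewrite -[X in F X](subrr 0) FB subrr.
have FN x : F (- x) = - F x by have := FB 0 x; rewrite !sub0r F0 sub0r.
have FD x y : F (x + y) = F x + F y by have := FB x (- y); rewrite FN !opprK.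
have Frel x : tensor_rel phi x -> F x = 0.
  elim=> [//|a b _ Fa _ Fb|p q s|p s t|r p s].
  - by rewrite FB Fa Fb subrr.
  - by rewrite FB FD !Fg betaDl subrr.
  - by rewrite FB FD !Fg betaDr subrr.
  - by rewrite FB !Fg betaB subrr.
pose f (u : tensor phi P) : B := F (repr u).
pose tpi x : tensor phi P := \pi_(Quotient.quot (tensor_pred phi (P := P)))%qT x.
have tpiB x y : tpi (x - y) = tpi x - tpi y by exact: raddfB.
have tpiK u : tpi (repr u) = u by exact: reprK.
have fpi x : f (tpi x) = F x.
  apply/eqP; rewrite -subr_eq0 -FB; apply/eqP/Frel/tensor_eq.
  exact: tpiK.
have fp p s : f (pure_tensor phi p s) = beta p s by rewrite -Fg -fpi.
have fB u v : f (u - v) = f u - f v.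
  by rewrite -[u]tpiK -[v]tpiK -tpiB !fpi FB.
have f0 : f 0 = 0 by rewrite -[X in f X](subrr 0) fB subrr.
have fN x : f (- x) = - f x by rewrite -sub0r fB f0 sub0r.
have fD x y : f (x + y) = f x + f y by rewrite -[y in LHS]opprK fB fN opprK.
have fl : linear f.
  move=> s u v; rewrite fD; congr (_ + _).
  elim/(@tensor_ind R S phi P): u => [|u w Eu Ew|p t].
  - by rewrite scaler0 f0 scaler0.
  - by rewrite scalerBr !fB Eu Ew scalerBr.
  - by rewrite -[s *: _]/(tensor_scale s _) tensor_scale_pure !fp betaZ.
by have [g gE] := linear_ex fl; exists g => p s; rewrite gE.
Qed.

Definition unit_tensor (p : P) : tensor phi P := pure_tensor phi p 1.

Lemma pure_tensorE p s : pure_tensor phi p s = s *: unit_tensor p.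
Proof. by rewrite -[s *: _]/(tensor_scale s _) tensor_scale_pure mulr1. Qed.

Lemma unit_tensorD p q : unit_tensor (p + q) = unit_tensor p + unit_tensor q.
Proof. exact: pure_tensorDl. Qed.

Lemma unit_tensorZ r p : unit_tensor (r *: p) = phi r *: unit_tensor p.
Proof. by rewrite /unit_tensor pure_tensor_bal mulr1 pure_tensorE. Qed.

Fact unit_tensor_is_zmod_morphism : zmod_morphism unit_tensor.
Proof.
move=> p q; apply/eqP; rewrite eq_sym subr_eq -unit_tensorD.
by rewrite subrK.
Qed.

HB.instance Definition _ := GRing.isZmodMorphism.Build P (tensor phi P)
  unit_tensor unit_tensor_is_zmod_morphism.

Lemma unit_tensor_act m n p (A : 'M[R]_(m, n)) (x : 'M[P]_(n, p)) :
  map_mx unit_tensor (A *v x) = map_mx phi A *v map_mx unit_tensor x.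
Proof.
apply/matrixP => i j; rewrite !mxE raddf_sum; apply: eq_bigr => k _.
by rewrite /= unit_tensorZ !mxE.
Qed.

Lemma sum_delta_seq (l : seq P) (p : P) :
  uniq l -> p \in l -> \sum_(q <- l) (q == p)%:R *: q = p.
Proof.
move=> ul pl; rewrite (bigD1_seq p) //= eqxx scale1r big1 ?addr0 //.
by move=> q /negPf ->; rewrite scale0r.
Qed.

(** Coefficientwise form of the relations that define the tensor product.  A
    formal sum is sent by [F] to the function that collects, for each [q], the
    scalars paired with [q].  Relations in the second variable are sent to [0];
    the other ones are multiples by [S] of relators [d j], which are linear
    relations over [R] between finitely many elements of [P].  Here [l] bounds
    these elements: a relation holds when it is summed over any finite set
    containing [l], since coefficients outside of it vanish. *)
Lemma tensor_rel_relators (F : {freeg (P * S)%type / int} -> (P -> S)) x :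
  (forall x y, F (x - y) = F x - F y) ->
  (forall p s, F << (p, s) >> = fun q => s * (q == p)%:R) ->
  tensor_rel phi x ->
  exists L (u : 'I_L -> S) (d : 'I_L -> P -> R) (l : seq P),
    (forall q, F x q = \sum_j u j * phi (d j q)) /\
    forall l', uniq l' -> {subset l <= l'} ->
      forall j, \sum_(q <- l') d j q *: q = 0.
Proof.
move=> FB Fg.
have F0 : F 0 = 0 by rewrite -[X in F X](subrr 0) FB subrr.
have FN y : F (- y) = - F y by have := FB 0 y; rewrite !sub0r F0 sub0r.
have FD y z : F (y + z) = F y + F z by have := FB y (- z); rewrite FN !opprK.
have pd (q p : P) : phi (q == p)%:R = (q == p)%:R by exact: rmorph_nat.
elim=> [|a b _ [L1 [u1 [d1 [l1 [F1 D1]]]]] _ [L2 [u2 [d2 [l2 [F2 D2]]]]]|p q s|p s t|r p s].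
- exists 0%N, (fun=> 0), (fun=> fun=> 0), [::]; split=> [q|l' _ _ []//].
  by rewrite big_ord0 F0.
- exists (L1 + L2)%N.
  exists (fun j => match fintype.split j with inl i => u1 i | inr i => - u2 i end).
  exists (fun j => match fintype.split j with inl i => d1 i | inr i => d2 i end).
  exists (l1 ++ l2); split=> [q|l' ul' sub j].
    rewrite big_split_ord FB /=; congr (_ + _).
      by rewrite F1; apply: eq_bigr => i _; rewrite (unsplitK (inl i)).
    rewrite -[LHS]/(- (F b q)) F2 -sumrN.
    by apply: eq_bigr => i _; rewrite (unsplitK (inr i)) mulNr.
  case: (fintype.split j) => i.
    by apply: D1 => // y yl; apply: sub; rewrite mem_cat yl.
  by apply: D2 => // y yl; apply: sub; rewrite mem_cat yl orbT.
- exists 1%N, (fun=> s), (fun=> fun y => (y == p + q)%:R - ((y == p)%:R + (y == q)%:R)).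
  exists [:: p + q; p; q]; split=> [y|l' ul' sub _].
    rewrite big_ord1 rmorphB rmorphD !pd FB FD !Fg /=.
    by rewrite -[LHS]/(_ - (_ + _)) -mulrDr -mulrBr.
  under eq_bigr => y _ do rewrite scalerBl scalerDl.
  rewrite big_split sumrN big_split /=.
  by rewrite !sum_delta_seq ?subrr //; apply: sub; rewrite !inE eqxx ?orbT.
- exists 0%N, (fun=> 0), (fun=> fun=> 0), [::]; split=> [q|l' _ _ []//].
  rewrite big_ord0 FB FD !Fg -[LHS]/(_ - (_ + _)).
  by rewrite -mulrDl subrr.
- exists 1%N, (fun=> s), (fun=> fun y => (y == r *: p)%:R - r * (y == p)%:R).
  exists [:: r *: p; p]; split=> [y|l' ul' sub _].
    rewrite big_ord1 rmorphB rmorphM !pd FB !Fg /=.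
    by rewrite -[LHS]/(_ - _) mulrBr mulrA [phi r * s]mulrC.
  under eq_bigr => y _ do rewrite scalerBl -scalerA.
  rewrite big_split sumrN -scaler_sumr /=.
  by rewrite !sum_delta_seq ?subrr //; apply: sub; rewrite !inE eqxx ?orbT.
Qed.

(** The tuple [z] lists all elements of [P] that occur in the [p i] and in the
    relators involved, so that [E] consists of unit vectors and [D] of the
    relators. *)
Lemma tensor_vanish_row n (p : 'cV[P]_n) (s : 'rV[S]_n) :
  s *v map_mx unit_tensor p = 0 ->
  exists N L (z : 'cV[P]_N) (E : 'M[R]_(n, N)) (D : 'M[R]_(L, N)) (U : 'rV[S]_L),
    [/\ p = E *v z, D *v z = 0 & s *m map_mx phi E = U *m map_mx phi D].
Proof.
move=> /matrixP/(_ 0 0); rewrite !mxE => sp0.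
have [F FB Fg] := formal_lift (fun p (s : S) => (fun q : P => s * (q == p)%:R : S)).
pose x : {freeg (P * S)%type / int} := \sum_i << (p i 0, s 0 i) >>.
have F0 : F 0 = 0 by rewrite -[X in F X](subrr 0) FB subrr.
have FN y : F (- y) = - F y by have := FB 0 y; rewrite !sub0r F0 sub0r.
have FD y z : F (y + z) = F y + F z by have := FB y (- z); rewrite FN !opprK.
have Fx q : F x q = \sum_i s 0 i * (q == p i 0)%:R.
  rewrite /x; elim/big_rec2: _ => [|i y z _ <-]; first by rewrite F0.
  by rewrite FD Fg.
have /(tensor_rel_relators FB Fg) [L [u [d [l [Fxd dl]]]]] : tensor_rel phi x.
  rewrite -[x]subr0; apply/tensor_eq; rewrite [RHS]raddf0 /x raddf_sum.
  rewrite -[RHS]sp0; apply: eq_bigr => i _; rewrite mxE -pure_tensorE.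
  by [].
pose l' := undup (l ++ [seq p i 0 | i <- enum 'I_n]).
have ul' : uniq l' by exact: undup_uniq.
have ll' : {subset l <= l'} by move=> y yl; rewrite mem_undup mem_cat yl.
have pl' i : p i 0 \in l'.
  by rewrite mem_undup mem_cat; apply/orP; right; apply: map_f; rewrite mem_enum.
pose z : 'cV[P]_(size l') := \col_i l'`_i.
have sumz (f : P -> R) : \sum_a f (z a 0) *: z a 0 = \sum_(q <- l') f q *: q.
  rewrite (big_nth 0) big_mkord; apply: eq_bigr => a _.
  by rewrite mxE.
exists (size l'), L, z, (\matrix_(i, a) (z a 0 == p i 0)%:R),
  (\matrix_(j, a) d j (z a 0)), (\row_j u j); split.
- apply/matrixP => i j; rewrite ord1 !mxE.
  under eq_bigr => a _ do rewrite mxE.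
  by rewrite (sumz (fun y => (y == p i 0)%:R)) sum_delta_seq.
- apply/matrixP => i j; rewrite ord1 !mxE.
  under eq_bigr => a _ do rewrite mxE.
  by rewrite (sumz (fun y => d i y)) dl.
- apply/matrixP => i a; rewrite ord1 mxE [RHS]mxE.
  transitivity (F x (z a 0)).
    by rewrite Fx; apply: eq_bigr => k _; rewrite !mxE rmorph_nat.
  by rewrite Fxd; apply: eq_bigr => j _; rewrite !mxE.
Qed.

(** The equational criterion for vanishing in a tensor product: relations [T] over
    [S] between the elements [p] follow from relations [D] over [R] between
    elements [z] that generate [p].  The rows of [T] are treated one after the
    other, each one refining the generators found for the previous ones. *)
Lemma tensor_vanish h n (p : 'cV[P]_n) (T : 'M[S]_(h, n)) :
  T *v map_mx unit_tensor p = 0 ->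
  exists N L (z : 'cV[P]_N) (E : 'M[R]_(n, N)) (D : 'M[R]_(L, N)) (U : 'M[S]_(h, L)),
    [/\ p = E *v z, D *v z = 0 & T *m map_mx phi E = U *m map_mx phi D].
Proof.
elim: h n p T => [|h IH] n p T.
  move=> _; exists n, 0%N, p, 1%:M, 0, 0; split; first by rewrite act1.
    by rewrite act0l.
  exact: mx0rows.
move: T; rewrite -[h.+1]/(1 + h)%N => T.
rewrite -[T]vsubmxK act_col -col_mx0 => /eq_col_mx[].
move: (usubmx _) (dsubmx _) => s T'.
move=> /tensor_vanish_row[N [L [z [E [D [U [pE Dz sE]]]]]]].
rewrite pE unit_tensor_act actA => /IH[N' [L' [z' [E' [D' [U' [zE Dz' TE]]]]]]].
exists N', (L + L')%N, z', (E *m E'), (col_mx (D *m E') D').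
exists (block_mx U 0 0 U'); split.
- by rewrite -actA -zE.
- by rewrite act_col -actA -zE Dz Dz' col_mx0.
- rewrite map_col_mx !map_mxM mulmxA mul_col_mx mul_block_col !mul0mx addr0 add0r.
  by rewrite sE mul_col_mx TE !mulmxA.
Qed.

End TensorLift.

(** * Quotients, direct summands and direct sums *)

Section QuotientModule.
Context {R : pzRingType} {M : lmodType R}.

Record submodule := Submodule { submodule_set :> M -> Prop; submoduleP : submod submodule_set }.

Variable K : submodule.

Definition submodule_pred : {pred M} := fun x => `[< K x >].

Fact submodule_pred_zmod_closed : zmod_closed submodule_pred.
Proof.
split; first by apply/asboolP; case: (submoduleP K).
move=> x y /asboolP Kx /asboolP Ky; apply/asboolP.
by apply: submodB => //; exact: submoduleP.
Qed.

HB.instance Definition _ :=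
  GRing.isZmodClosed.Build M submodule_pred submodule_pred_zmod_closed.

Definition quotient_module : Type := Quotient.quot submodule_pred.
HB.instance Definition _ := GRing.Zmodule.on quotient_module.

Definition quotient_class (x : M) : quotient_module :=
  (\pi_(Quotient.quot submodule_pred) x)%qT.

Lemma quotient_class_eq x y : quotient_class x = quotient_class y <-> K (x - y).
Proof.
split=> [/eqP|Kxy]; last apply/eqP.
  by rewrite /quotient_class -Quotient.idealrBE => /asboolP.
by rewrite /quotient_class -Quotient.idealrBE; apply/asboolP.
Qed.

Lemma quotient_class_repr (u : quotient_module) : quotient_class (repr u) = u.
Proof. exact: reprK. Qed.

Fact quotient_class_is_zmod_morphism : zmod_morphism quotient_class.
Proof. by move=> x y; rewrite /quotient_class raddfB. Qed.

HB.instance Definition _ := GRing.isZmodMorphism.Build M quotient_module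
  quotient_class quotient_class_is_zmod_morphism.

Definition quotient_scale (a : R) (u : quotient_module) : quotient_module :=
  quotient_class (a *: repr u).

Lemma quotient_scaleE a x : quotient_scale a (quotient_class x) = quotient_class (a *: x).
Proof.
apply/quotient_class_eq; rewrite -scalerBr.
case: (submoduleP K) => _ _; apply; apply/quotient_class_eq.
exact: quotient_class_repr.
Qed.

Fact quotient_scaleA a b u : quotient_scale a (quotient_scale b u) = quotient_scale (a * b) u.
Proof. by rewrite -[u]quotient_class_repr !quotient_scaleE scalerA. Qed.

Fact quotient_scale1 : left_id 1 quotient_scale.
Proof. by move=> u; rewrite -[u]quotient_class_repr quotient_scaleE scale1r. Qed.

Fact quotient_scaleDr : right_distributive quotient_scale +%R.
Proof.
move=> a u v; rewrite -[u]quotient_class_repr -[v]quotient_class_repr.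
by rewrite -raddfD !quotient_scaleE -raddfD scalerDr.
Qed.

Fact quotient_scaleDl u : {morph quotient_scale^~ u : a b / a + b}.
Proof.
by move=> a b; rewrite -[u]quotient_class_repr !quotient_scaleE -raddfD scalerDl.
Qed.

HB.instance Definition _ := GRing.Zmodule_isLmodule.Build R quotient_module
  quotient_scaleA quotient_scale1 quotient_scaleDr quotient_scaleDl.

Fact quotient_class_is_scalable : scalable quotient_class.
Proof. by move=> a x; rewrite -[RHS]/(quotient_scale a _) quotient_scaleE. Qed.

HB.instance Definition _ := GRing.isScalable.Build R M quotient_module *:%R
  quotient_class quotient_class_is_scalable.

Lemma quotient_class_eq0 x : quotient_class x = 0 <-> K x.
Proof. by rewrite -(raddf0 quotient_class) quotient_class_eq subr0. Qed.

Lemma quotient_lift (M' : lmodType R) (f : {linear M -> M'}) :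
  (forall x, K x -> f x = 0) ->
  exists g : {linear quotient_module -> M'}, forall x, g (quotient_class x) = f x.
Proof.
move=> fK; pose g (u : quotient_module) := f (repr u).
have gE x : g (quotient_class x) = f x.
  apply/eqP; rewrite -subr_eq0 -linearB; apply/eqP/fK/quotient_class_eq.
  exact: quotient_class_repr.
have lg : linear g.
  move=> a u v; rewrite -[u]quotient_class_repr -[v]quotient_class_repr -linearP.
  by rewrite !gE linearP.
by have [h hE] := linear_ex lg; exists h => x; rewrite hE.
Qed.

End QuotientModule.
Arguments submodule {R} M.

(** The complement is the quotient of [D] by the retract, which [d - f (g d)]
    identifies with the kernel of [g]. *)
Lemma retract_summand (R : pzRingType) (M D : lmodType R)
  (f : {linear M -> D}) (g : {linear D -> M}) :
  cancel f g -> isom_direct_summand M D.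
Proof.
move=> fK.
have sI : submod (fun d => exists x, f x = d).
  split=> [|_ _ [x <-] [y <-]|a _ [x <-]].
  - by exists 0; rewrite linear0.
  - by exists (x + y); rewrite linearD.
  - by exists (a *: x); exact: linearZ.
pose K := Submodule sI.
have lp : linear (fun d => d - f (g d)).
  move=> a x y; have -> : f (g (a *: x + y)) = a *: f (g x) + f (g y).
    by rewrite (linearP g) (linearP f).
  by rewrite scalerBr opprD addrACA.
have [p pE] := linear_ex lp.
have pK x : K x -> p x = 0 by case=> y <-; rewrite pE fK subrr.
have [q qE] := quotient_lift pK.
have lh : linear (fun u : M * quotient_module K => f u.1 + q u.2).
  by move=> a [x u] [y v] /=; rewrite !linearP scalerDr addrACA.
have [h hE] := linear_ex lh.
exists (quotient_module K), h.
exists (fun d => (g d, quotient_class K d)) => [[x u]|d]; rewrite hE /=; last first.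
  by rewrite qE pE subrKC.
rewrite -[u]quotient_class_repr qE pE; move: (repr u) => d; congr pair.
  by rewrite linearD linearB !fK subrr addr0.
apply/quotient_class_eq; exists (x - g d).
by rewrite linearB -addrA; congr (_ + _); rewrite addrAC subrr add0r.
Qed.

Section DirectSumTheory.
Context {R : pzRingType} (I : Type) (F : I -> lmodType R).

Definition single_fun i (x : F i) : forall j, F j := fun j =>
  match pselect (i = j) with left e => eq_rect i (fun k => F k) x j e | right _ => 0 end.

Lemma single_funE i (x : F i) : single_fun x i = x.
Proof.
rewrite /single_fun; case: pselect => // e.
by rewrite (Prop_irrelevance e erefl).
Qed.

Lemma single_fun_neq i j (x : F i) : i <> j -> single_fun x j = 0.
Proof. by rewrite /single_fun; case: pselect. Qed.

Fact single_finite i (x : F i) : Defs.finite_support (single_fun x).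
Proof.
apply: sub_finite_set (finite_set1 i) => j /= nz.
by apply: contrapT => ji; apply: nz; apply: single_fun_neq => ij; apply: ji.
Qed.

Definition single i (x : F i) : direct_sum F := DirectSum (single_finite x).

Fact single_is_linear i : linear (@single i).
Proof.
move=> a x y; apply: direct_sum_ext => j /=.
have [ij|ij] := pselect (i = j); last first.
  by rewrite -[RHS]/(a *: single_fun x j + single_fun y j) !single_fun_neq // scaler0 addr0.
case: _ / ij; rewrite -[RHS]/(a *: single_fun x i + single_fun y i).
by rewrite !single_funE.
Qed.

HB.instance Definition _ i := GRing.isLinear.Build R (F i) (direct_sum F) *:%R
  (@single i) (@single_is_linear i).

Definition component i (d : direct_sum F) : F i := d i.

Arguments component : simpl never.
Arguments single : simpl never.

Fact component_is_linear i : linear (@component i).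
Proof. by []. Qed.

HB.instance Definition _ i := GRing.isLinear.Build R (direct_sum F) (F i) *:%R
  (@component i) (@component_is_linear i).

Lemma component_single i (x : F i) : component i (single x) = x.
Proof. exact: single_funE. Qed.

Lemma component_single_neq i j (x : F i) : i <> j -> component j (single x) = 0.
Proof. exact: single_fun_neq. Qed.

Lemma direct_sum_support (d : direct_sum F) :
  exists l : seq {classic I}, uniq l /\ forall i, component i d <> 0 -> (i : {classic I}) \in l.
Proof.
have /(@finite_seqP {classic I})[l lE] := direct_sumP d.
exists (undup l); split; first exact: undup_uniq.
move=> i di; rewrite mem_undup.
by have : [set` l]%classic i by rewrite -lE.
Qed.

(** Induction on a list that covers the support of [d]. *)
Lemma direct_sum_span (K : direct_sum F -> Prop) (d : direct_sum F) :
  submod K -> (forall i, K (single (component i d))) -> K d.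
Proof.
move=> [K0 KD _]; have [l [_ dl]] := direct_sum_support d.
elim: l d dl => [|i l IH] d dl Kd.
  rewrite (_ : d = 0) //; apply: direct_sum_ext => j.
  by apply: contrapT => /dl.
rewrite -(subrK (single (component i d)) d); apply: (KD) => //.
have dE j : component j (d - single (component i d)) =
    if pselect (i = j) then 0 else component j d.
  rewrite linearB; case: pselect => [ij|ij] /=; last by rewrite component_single_neq ?subr0.
  by case: _ / ij; rewrite component_single subrr.
apply: IH => j; rewrite dE; case: pselect => //= ij.
  by move/dl; rewrite inE => /predU1P[ji|//]; case: ij.
by rewrite raddf0.
Qed.

(** The value on [d] is the sum of the [h i (component i d)]; linearity is checked
    on a common finite list of indices that covers the supports involved. *)
Lemma direct_sum_lift (M : lmodType R) (h : forall i, {linear F i -> M}) :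
  exists f : {linear direct_sum F -> M}, forall i x, f (single x) = h i x.
Proof.
pose f (d : direct_sum F) : M := (\sum_(i \in [set: {classic I}]%classic) h i (component i d)).
have fE (l : seq {classic I}) d : uniq l -> (forall i, component i d <> 0 -> (i : {classic I}) \in l) ->
    f d = \sum_(i <- l) h i (component i d).
  move=> ul dl; rewrite fsbig_seq //; apply/esym/fsbig_widen => // i [_ /= il].
  have -> : component i d = 0 by apply: contrapT => /dl.
  by rewrite linear0.
have lf : linear f.
  move=> a x y; have [lx [_ xl]] := direct_sum_support x.
  have [ly [_ yl]] := direct_sum_support y.
  pose l := undup (lx ++ ly); have ul : uniq l by exact: undup_uniq.
  have {}xl i : component i x <> 0 -> (i : {classic I}) \in l.
    by move=> /xl il; rewrite mem_undup mem_cat il.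
  have {}yl i : component i y <> 0 -> (i : {classic I}) \in l.
    by move=> /yl il; rewrite mem_undup mem_cat il orbT.
  have xyl i : component i (a *: x + y) <> 0 -> (i : {classic I}) \in l.
    have [x0|/xl//] := pselect (component i x = 0).
    have [y0|/yl//] := pselect (component i y = 0).
    rewrite (_ : component i (a *: x + y) = a *: component i x + component i y) //.
    by rewrite x0 y0 scaler0 addr0.
  rewrite !(fE l) // scaler_sumr -big_split; apply: eq_bigr => i _ /=.
  by rewrite -(linearP (h i)).
have [g gE] := linear_ex lf; exists g => i x; rewrite gE.
rewrite (fE [:: i]) ?big_seq1 ?component_single // => j.
have [ij|ij] := pselect (i = j); first by case: _ / ij; rewrite mem_seq1 eqxx.
by rewrite component_single_neq.
Qed.

End DirectSumTheory.

(** * Presentations and base change *)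

Section Presentations.
Context {R : pzRingType} {M : lmodType R}.

Definition presents n k (e : 'cV[M]_n) (A : 'M[R]_(k, n)) : Prop :=
  [/\ forall N (y : 'cV[M]_N), exists W : 'M_(N, n), y = W *v e,
      forall h (X : 'M[R]_(h, n)), X *v e = 0 -> exists B, X = B *m A
    & A *v e = 0].

Lemma matrix_rows_choice h n (Q : 'I_h -> 'rV[R]_n -> Prop) :
  (forall i, exists x, Q i x) -> exists W : 'M[R]_(h, n), forall i, Q i (row i W).
Proof.
move=> /choice[f fP]; exists (\matrix_i f i) => i.
by rewrite rowK.
Qed.

Lemma linear_rV n (g : {linear 'rV[R]_n -> M}) x :
  g x = (x *v (\col_j g (delta_mx 0 j) : 'cV_n)) 0 0.
Proof.
rewrite {1}[x]row_sum_delta linear_sum mxE; apply: eq_bigr => j _.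
by rewrite linearZ mxE.
Qed.

Lemma act_row m n p (A : 'M[R]_(m, n)) (x : 'M[M]_(n, p)) i :
  row i (A *v x) = row i A *v x.
Proof.
by apply/rowP => j; rewrite !mxE; apply: eq_bigr => k _; rewrite !mxE.
Qed.

Lemma finitely_presentedP :
  finitely_presented M <-> exists n k (e : 'cV[M]_n) (A : 'M[R]_(k, n)), presents e A.
Proof.
split=> [[n [k [g [f [gsurj gker]]]]]|[n [k [e [A [esurj eker Ae]]]]]].
  pose e : 'cV[M]_n := \col_j g (delta_mx 0 j).
  have gE x : x *v e = (g x)%:M by rewrite linear_rV [LHS]mx11_scalar.
  have fE z : f z = z *m lin1_mx f by rewrite mul_rV_lin1.
  have ker (x : 'rV[R]_n) : x *v e = 0 -> exists z : 'rV_k, x = z *m lin1_mx f.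
    move/matrixP/(_ 0 0); rewrite -linear_rV mxE => /gker[z <-].
    by exists z.
  exists n, k, e, (lin1_mx f); split.
  - move=> N y; have [W WP] := matrix_rows_choice (fun i => gsurj (y i 0)).
    exists W; apply/matrixP => i j; rewrite ord1 -WP linear_rV -act_row.
    by rewrite [LHS]mxE.
  - move=> h X Xe.
    have Xr i : exists z, row i X = z *m lin1_mx f.
      by apply: ker; rewrite -act_row Xe row0.
    have [B BP] := matrix_rows_choice Xr; exists B; apply/row_matrixP => i.
    by rewrite row_mul BP.
  - apply/row_matrixP => i; rewrite act_row row0 rowE -fE gE.
    have -> : g (f (delta_mx 0 i)) = 0 by apply/gker; exists (delta_mx 0 i).
    by rewrite raddf0.
have lg : linear (fun x : 'rV[R]_n => (x *v e) 0 0).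
  move=> a x y; rewrite actDl mxE; congr (_ + _).
  by rewrite actZl_entry.
have lf : linear (fun z : 'rV[R]_k => z *m A).
  by move=> a x y; rewrite mulmxDl -scalemxAl.
have [g gE] := linear_ex lg; have [f fE] := linear_ex lf.
exists n, k, g, f; split=> [y|x].
  have [W yE] := esurj 1%N (y%:M).
  by exists W; rewrite gE -yE mxE eqxx mulr1n.
rewrite gE; split=> [x0|[z <-]]; last by rewrite fE -actA Ae act0r mxE.
have [|B ->] := eker _ x; last by exists B; rewrite fE.
by apply/matrixP => i j; rewrite !ord1 x0 mxE.
Qed.

Lemma summand_retract (D : lmodType R) :
  isom_direct_summand M D ->
  exists (f : {linear M -> D}) (g : {linear D -> M}), cancel f g.
Proof.
move=> [Q [h [h' hK h'K]]].
have lf : linear (fun x : M => h (x, 0)).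
  by move=> a x y; rewrite -linearP; congr (h _); congr pair; rewrite /= scaler0 addr0.
have lg : linear (fun d : D => (h' d).1).
  move=> a x y; rewrite -[X in h' X]/(_ + _) -{1}[x]h'K -{1}[y]h'K -linearP hK.
  by [].
have [f fE] := linear_ex lf; have [g gE] := linear_ex lg.
by exists f, g => x; rewrite gE fE hK.
Qed.

End Presentations.

Section BaseChange.
Context {R S : comPzRingType} (phi : {rmorphism R -> S}).

Lemma tensor_map (M N : lmodType R) (f : {linear M -> N}) :
  exists g : {linear tensor phi M -> tensor phi N},
    forall p s, g (pure_tensor phi p s) = pure_tensor phi (f p) s.
Proof.
apply: tensor_lift => [p q s|p s t|r p s|p s t].
- by rewrite linearD pure_tensorDl.
- by rewrite pure_tensorDr.
- by rewrite linearZ pure_tensor_bal.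
- by rewrite -[RHS]/(tensor_scale s _) tensor_scale_pure.
Qed.

(** A presentation [(e, A)] of [M] is mapped to a presentation of the tensor
    product.  By the equational criterion a relation [X] of the tensors
    [e (x) 1] comes from relations over [R] between elements [z] of [M];
    expressing [z] through [e] turns these into combinations of the rows
    of [A]. *)
Lemma tensor_finitely_presented (M : lmodType R) :
  finitely_presented M -> finitely_presented (tensor phi M : lmodType S).
Proof.
move=> /finitely_presentedP[n [k [e [A [esurj eker Ae]]]]].
apply/finitely_presentedP.
pose e' := map_mx (unit_tensor phi (P := M)) e; pose A' := map_mx phi A.
exists n, k, e', A'; split.
- have surj (u : tensor phi M) : exists W : 'rV[S]_n, u = (W *v e') 0 0.
    elim/(@tensor_ind R S phi M): u => [|u v [U ->] [V ->]|p s].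
    + by exists 0; rewrite act0l mxE.
    + by exists (U - V); rewrite actBl !mxE.
    + have [W pE] := esurj 1%N (p%:M).
      exists (s *: map_mx phi W).
      have -> : p = (W *v e) 0 0 by rewrite -pE mxE eqxx mulr1n.
      rewrite pure_tensorE.
      have -> : unit_tensor phi ((W *v e) 0 0) = (map_mx phi W *v e') 0 0.
        by rewrite -unit_tensor_act [RHS]mxE.
      by rewrite actZl_entry.
  move=> N y; have [W WP] := matrix_rows_choice (fun i => surj (y i 0)).
  exists W; apply/matrixP => i j; rewrite ord1 WP -act_row.
  by rewrite [LHS]mxE.
- move=> h X /tensor_vanish[N [L [z [E [D [U [eE Dz XE]]]]]]].
  have [W zE] := esurj _ z.
  have [B1 B1E] : exists B, 1%:M - E *m W = B *m A.
    by apply: eker; rewrite actBl act1 -actA -zE -eE subrr.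
  have [B2 B2E] : exists B, D *m W = B *m A.
    by apply: eker; rewrite -actA -zE.
  exists (X *m map_mx phi B1 + U *m map_mx phi B2).
  have {1}-> : X = X *m map_mx phi (1%:M - E *m W) + X *m map_mx phi (E *m W).
    by rewrite -mulmxDr -map_mxD subrK map_mx1 mulmx1.
  rewrite B1E !map_mxM !mulmxA XE -[U *m _ *m _]mulmxA -map_mxM B2E.
  by rewrite map_mxM mulmxDl -!mulmxA.
- by rewrite -unit_tensor_act Ae; apply/matrixP => i j; rewrite !mxE raddf0.
Qed.

(** The two maps of a retraction from the direct sum of the [F i] onto [P] induce,
    summand by summand, maps between the direct sum of the [F' i] and the tensor
    product of [P]; that they again form a retraction is checked on pure
    tensors. *)
Lemma tensor_pure_projective (P : lmodType R) :
  pure_projective P -> pure_projective (tensor phi P : lmodType S).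
Proof.
move=> [I [F [Ffp /summand_retract[f [g fK]]]]].
pose F' i : lmodType S := tensor phi (F i).
exists I, F'; split=> [i|]; first exact: tensor_finitely_presented.
have fin (d : direct_sum F) s : Defs.finite_support (fun i => pure_tensor phi (component i d) s : F' i).
  apply: sub_finite_set (direct_sumP d) => i /= nz di0; apply: nz.
  by rewrite -[X in pure_tensor phi X s]/(d i) di0 pure_tensorE raddf0 scaler0.
pose beta d s : direct_sum F' := DirectSum (@fin d s).
have betaDl d d' s : beta (d + d') s = beta d s + beta d' s.
  by apply: direct_sum_ext => i; exact: pure_tensorDl.
have betaDr d s t : beta d (s + t) = beta d s + beta d t.
  by apply: direct_sum_ext => i; exact: pure_tensorDr.
have betaB r d s : beta (r *: d) s = beta d (phi r * s).
  by apply: direct_sum_ext => i; exact: pure_tensor_bal.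
have betaZ d s t : beta d (s * t) = s *: beta d t.
  apply: direct_sum_ext => i /=.
  by rewrite pure_tensorE -scalerA -pure_tensorE.
have [f' f'E] : exists f' : {linear tensor phi P -> direct_sum F'},
    forall p s, f' (pure_tensor phi p s) = beta (f p) s.
  apply: tensor_lift => [p q s|p s t|r p s|p s t] //.
  - by rewrite linearD betaDl.
  - by rewrite linearZ betaB.
have hP i : exists h : {linear F' i -> tensor phi P},
    forall x s, h (pure_tensor phi x s) = pure_tensor phi (g (single x)) s.
  have lgi : linear (fun x : F i => g (single x)).
    by move=> a x y; rewrite linearP (linearP g).
  have [gi giE] := linear_ex lgi; have [h hE] := tensor_map gi.
  by exists h => x s; rewrite hE giE.
pose h i : {linear F' i -> tensor phi P} := projT1 (cid (hP i)).
have hE i x s : h i (pure_tensor phi x s) = pure_tensor phi (g (single x)) s.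
  exact: (projT2 (cid (hP i))).
have [g' g'E] := direct_sum_lift h.
have g'beta d s : g' (beta d s) = pure_tensor phi (g d) s.
  have sK : submod (fun d => forall s, g' (beta d s) = pure_tensor phi (g d) s).
    split=> [t|x y Kx Ky t|a x Kx t].
    - rewrite linear0 pure_tensorE raddf0 scaler0 -(linear0 g'); congr (g' _).
      by apply: direct_sum_ext => i /=; rewrite pure_tensorE raddf0 scaler0.
    - by rewrite betaDl !linearD pure_tensorDl Kx Ky.
    - by rewrite betaB Kx linearZ pure_tensor_bal.
  apply: (direct_sum_span (d := d) sK) => i t; rewrite -hE -g'E; congr (g' _).
  apply: direct_sum_ext => j; rewrite -[RHS]/(component j (single _)).
  rewrite -[LHS]/(pure_tensor phi (component j (single (component i d))) t).
  have [ij|ij] := pselect (i = j).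
    by case: _ / ij; rewrite !component_single.
  by rewrite !component_single_neq // pure_tensorE raddf0 scaler0.
apply: (@retract_summand _ _ _ f' g') => u.
elim/(@tensor_ind R S phi P): u => [|u v Eu Ev|p s]; first by rewrite !linear0.
  by rewrite !linearB Eu Ev.
by rewrite f'E g'beta fK.
Qed.

End BaseChange.

(** * Finitely generated types and their descent *)

Section TypeGenerated.
Context {R : pzRingType} {M : lmodType R}.

(** A positive primitive formula [exists w, A x + B w = 0] holds for [b] in the
    quotient [M / K] when [A b + B w] is in [K] for some [w].  The formula
    [exists z, x = E z /\ D z = 0] implies it in all modules when
    [A E + B W = Y D] is solvable: then [w = W z] is a witness.  Thus
    [type_generated K b] says that one formula, true of [b] in [M / K], implies
    all the other ones true of [b]; when this holds for all tuples, [M / K] is a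
    Mittag-Leffler module.  Using matrices instead of all modules is what makes
    implications descend along pure ring morphisms. *)
Definition type_generated (K : M -> Prop) n (b : 'cV[M]_n) : Prop :=
  exists N L (E : 'M[R]_(n, N)) (D : 'M[R]_(L, N)) (z : 'cV[M]_N),
    [/\ allin K (b - E *v z), allin K (D *v z) &
      forall l k (A : 'M[R]_(l, n)) (B : 'M[R]_(l, k)) (w : 'cV[M]_k),
        allin K (A *v b + B *v w) -> exists W Y, A *m E + B *m W = Y *m D].

(** The relations of a presentation generate the type of its generators. *)
Lemma presents_type_generated n k (e : 'cV[M]_n) (A : 'M[R]_(k, n)) N (b : 'cV[M]_N) :
  presents e A -> type_generated (fun x => x = 0) b.
Proof.
move=> [esurj eker Ae]; have [V bE] := esurj _ b.
exists n, k, V, A, e; split; [by apply/allin_eq0; rewrite bE subrr | exact/allin_eq0 |].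
move=> l h C B w /allin_eq0; have [W ->] := esurj _ w.
rewrite bE !actA -actDl => /eker[Y E].
by exists W, Y.
Qed.

End TypeGenerated.

Lemma allin_map (T U : Type) (f : T -> U) (K : T -> Prop) (K' : U -> Prop) m n
  (x : 'M[T]_(m, n)) :
  (forall t, K t -> K' (f t)) -> (forall i j, K (x i j)) ->
  forall i j, K' (map_mx f x i j).
Proof. by move=> KK' Kx i j; rewrite mxE; apply: KK'. Qed.

Lemma type_generated_retract (R : pzRingType) (T M : lmodType R)
  (f : {linear T -> M}) (g : {linear M -> T})
  (K : T -> Prop) (K' : M -> Prop) n (b : 'cV[T]_n) :
  cancel f g -> (forall x, K x -> K' (f x)) -> (forall y, K' y -> K (g y)) ->
  type_generated K' (map_mx f b) -> type_generated K b.
Proof.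
move=> fK KK' K'K [N [L [E [D [z [bz Dz EP]]]]]].
have gf m p (x : 'M[T]_(m, p)) : map_mx g (map_mx f x) = x.
  by apply/matrixP => i j; rewrite !mxE fK.
exists N, L, E, D, (map_mx g z); split.
- by have := allin_map K'K bz; rewrite map_mxB map_act gf.
- by have := allin_map K'K Dz; rewrite map_act.
- move=> l k A B w Kw; apply: (EP l k A B (map_mx f w)).
  by rewrite -!map_act -map_mxD; exact: allin_map KK' Kw.
Qed.

Section DirectSumTypes.
Context {R : pzRingType} (I : Type) (F : I -> lmodType R).

Definition supported (J : I -> Prop) (d : direct_sum F) : Prop :=
  forall i, ~ J i -> component i d = 0.

Lemma supported_submod J : submod (supported J).
Proof.
split=> [//|x y Jx Jy i Ji|a x Jx i Ji].
  by rewrite -[LHS]/(component i x + component i y) Jx // Jy // addr0.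
by rewrite -[LHS]/(a *: component i x) Jx // scaler0.
Qed.

Definition erase i (d : direct_sum F) : direct_sum F := d - single (component i d).

Fact erase_is_linear i : linear (erase i).
Proof.
move=> a x y; rewrite /erase -[component i (a *: x + y)]/(a *: component i x + component i y).
by rewrite single_is_linear scalerBr opprD addrACA.
Qed.

HB.instance Definition _ i := GRing.isLinear.Build R (direct_sum F) (direct_sum F) *:%R
  (erase i) (@erase_is_linear i).

Lemma component_erase i d : component i (erase i d) = 0.
Proof. by rewrite -[LHS]/(component i d - component i (single (component i d))) component_single subrr. Qed.

Lemma component_erase_neq i j d : i <> j -> component j (erase i d) = component j d.
Proof.
move=> ij; rewrite -[LHS]/(component j d - component j (single (component i d))).
by rewrite component_single_neq // subr0.
Qed.

(** Only finitely many summands outside of [J] matter for a given tuple, and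
    they can be split off one at a time. *)
Lemma direct_sum_type_generated (J : I -> Prop) n (b : 'cV[direct_sum F]_n) :
  (forall i, finitely_presented (F i)) -> type_generated (supported J) b.
Proof.
move=> Ffp; have sJ := supported_submod J.
have [l bl] : exists l : seq {classic I}, forall i j k,
    component k (b i j) <> 0 -> J k \/ (k : {classic I}) \in l.
  have [f fP] := choice (fun i => direct_sum_support (b i 0)).
  exists (flatten [seq f i | i <- enum 'I_n]) => i j k; rewrite ord1 => /(fP i).2 kf.
  by right; apply/flattenP; exists (f i) => //; apply: map_f; rewrite mem_enum.
elim: l b bl => [|k l IH] b bl.
  exists 0%N, 0%N, 0, 0, 0; split.
  - move=> i j k Jk; rewrite act0l subr0.
    by apply: contrapT => /bl[].
  - by move=> [].
  - by move=> p q A B w _; exists 0, 0; exact: mx0cols.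
have [Jk|nJk] := pselect (J k).
  apply: IH => i j k' /bl[?|]; first by left.
  by rewrite inE => /predU1P[->|]; [left|right].
have [N1 [L1 [E1 [D1 [z1 [bz1 Dz1 EP1]]]]]] : type_generated (fun x => x = 0) (map_mx (@component _ _ F k) b).
  have [N [h [e [A eA]]]] := (finitely_presentedP.1 (Ffp k)).
  exact: presents_type_generated eA.
have [|N2 [L2 [E2 [D2 [z2 [bz2 Dz2 EP2]]]]]] := IH (map_mx (erase k) b).
  move=> i j k'; rewrite mxE; have [<-|kk'] := pselect (k = k').
    by rewrite component_erase.
  rewrite component_erase_neq // => /bl[?|]; first by left.
  by rewrite inE => /predU1P[/esym/kk'|]; [|right].
exists (N1 + N2)%N, (L1 + L2)%N, (row_mx E1 E2), (block_mx D1 0 0 D2).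
exists (col_mx (map_mx (@single _ _ F k) z1) z2); split.
- rewrite act_row_col -map_act.
  have -> : b = map_mx (@single _ _ F k) (map_mx (@component _ _ F k) b) + map_mx (erase k) b.
    by apply/matrixP => i j; rewrite !mxE addrC subrK.
  rewrite opprD addrACA -map_mxB; move/allin_eq0: bz1 => ->.
  by rewrite map_mx0 add0r.
- rewrite act_block !act0l addr0 add0r -map_act; move/allin_eq0: Dz1 => ->.
  by rewrite map_mx0; apply/allin_col; split=> //; apply: allin0.
- move=> p q A B w Jw.
  have [|W1 [Y1 WY1]] := EP1 p q A B (map_mx (@component _ _ F k) w).
    rewrite -!map_act -map_mxD; apply/allin_eq0/matrixP => i j; rewrite mxE [RHS]mxE.
    exact: Jw.
  have [|W2 [Y2 WY2]] := EP2 p q A B (map_mx (erase k) w).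
    rewrite -!map_act -map_mxD => i j; rewrite mxE => k' Jk'.
    have [<-|kk'] := pselect (k = k'); first by rewrite component_erase.
    by rewrite component_erase_neq // Jw.
  exists (row_mx W1 W2), (row_mx Y1 Y2).
  rewrite !mul_mx_row add_row_mx WY1 WY2 mul_row_block !mulmx0 addr0 add0r.
  by [].
Qed.

End DirectSumTypes.

Section TypeDescent.
Context {R S : comPzRingType} (phi : {rmorphism R -> S}) (P : lmodType R).
Local Notation tau := (unit_tensor phi (P := P)).

Definition tensor_span (P' : P -> Prop) (u : tensor phi P) : Prop :=
  exists n (p : 'cV[P]_n) (s : 'rV[S]_n), allin P' p /\ u%:M = s *v map_mx tau p.

Lemma tensor_span_unit P' p : P' p -> tensor_span P' (tau p).
Proof.
move=> P'p; exists 1%N, (p%:M), 1%:M; split.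
  by move=> i j; rewrite !ord1 mxE eqxx mulr1n.
by rewrite act1; apply/matrixP => i j; rewrite !ord1 !mxE eqxx !mulr1n.
Qed.

Lemma tensor_span_submod P' : submod (tensor_span P').
Proof.
split=> [|u v [n [p [s [P'p uE]]]] [k [q [t [P'q vE]]]]|a u [n [p [s [P'p uE]]]]].
- by exists 0%N, 0, 0; split; [case | rewrite act0l raddf0].
- exists (n + k)%N, (col_mx p q), (row_mx s t); split; first exact/allin_col.
  by rewrite map_col_mx act_row_col -uE -vE raddfD.
- exists n, p, (a *: s); split=> //; apply/matrixP => i j.
  by rewrite !ord1 actZl_entry -uE !mxE eqxx !mulr1n.
Qed.

Lemma tensor_span_tuple P' h (x : 'cV[tensor phi P]_h) :
  allin (tensor_span P') x ->
  exists n (p : 'cV[P]_n) (T : 'M[S]_(h, n)), allin P' p /\ x = T *v map_mx tau p.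
Proof.
elim: h x => [|h IH] x; first by exists 0%N, 0, 0; split; [case | exact: mx0rows].
move: x; rewrite -[h.+1]/(1 + h)%N => x; rewrite -[x]vsubmxK => /allin_col[x1 x2].
have [n [p [s [P'p uE]]]] := x1 0 0.
have [k [q [T [P'q vE]]]] := IH _ x2.
exists (n + k)%N, (col_mx p q), (block_mx s 0 0 T); split; first exact/allin_col.
by rewrite map_col_mx act_block !act0l addr0 add0r -vE -uE -mx11_scalar.
Qed.

Lemma tensor_span_setT u : tensor_span (fun=> True) u.
Proof.
have [K0 KD KZ] := tensor_span_submod (fun=> True).
elim/(@tensor_ind R S phi P): u => [//|u v Ku Kv|p s].
  by apply: submodB => //; exact: tensor_span_submod.
by rewrite pure_tensorE; apply: KZ; apply: tensor_span_unit.
Qed.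

(** The equations over [S] which express that [tau b] satisfies the generating
    formula modulo the span of [P'] involve finitely many elements [b], [p] of
    [P] and [p'] of [P'].  They follow from equations over [R] ([tensor_vanish]),
    and these, together with [p' = 0], form the generating formula over [R].
    It implies the given one over [S], hence also every formula over [R] true of
    [b] modulo [P'], first over [S] and then over [R] by purity. *)
Lemma type_generated_descent (P' : P -> Prop) n (b : 'cV[P]_n) :
  pure_morphism phi -> submod P' ->
  type_generated (tensor_span P') (map_mx tau b) -> type_generated P' b.
Proof.
move=> pure sP' [N [L [E [D [z [bz Dz EP]]]]]].
have sK := tensor_span_submod P'.
have [q [p [T [_ zE]]]] := tensor_span_tuple (fun i j => tensor_span_setT (z i j)).
have [q' [p' [T' [P'p']]]] := tensor_span_tuple ((allin_col _ _ _).2 (conj bz Dz)).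
rewrite -[T']vsubmxK act_col => /eq_col_mx[].
move: (usubmx T') (dsubmx T') => T1 T2 {T'} bE DE.
(* Q (b, p, p') = 0 collects b = E T p + T1 p' and D T p = T2 p' *)
pose Q := block_mx 1%:M (row_mx (- (E *m T)) (- T1)) 0 (row_mx (D *m T) (- T2)).
have : Q *v map_mx tau (col_mx b (col_mx p p')) = 0.
  rewrite !map_col_mx act_block !act_row_col act1 act0l add0r !actNl -!actA -zE.
  by rewrite addrA bE DE !subrr col_mx0.
case/tensor_vanish => [N' [L' [z' [E' [D' [U [bpE Dz']]]]]]].
rewrite -[E']vsubmxK -[dsubmx E']vsubmxK -[U]vsubmxK in bpE *.
move: (usubmx E') (usubmx (dsubmx E')) (dsubmx (dsubmx E')) (usubmx U) (dsubmx U) bpE.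
move=> Eb Ep Ep' U1 U2 {E' U}.
rewrite !act_col => /eq_col_mx[bE' /eq_col_mx[_ p'E]].
rewrite !map_col_mx mul_block_col !mul_row_col mul1mx mul0mx add0r mul_col_mx.
case/eq_col_mx; rewrite !mulNmx => rel1 rel2.
exists N', (L' + q')%N, Eb, (col_mx D' Ep'), z'; split.
- by rewrite bE' subrr; apply: allin0.
- by rewrite act_col Dz' -p'E; apply/allin_col; split=> //; apply: allin0.
- move=> l k A B w P'w; apply: pure.
  have [|W [Y WY]] := EP l k (map_mx phi A) (map_mx phi B) (map_mx tau w).
    rewrite -!unit_tensor_act -map_mxD => i j; rewrite mxE.
    exact: tensor_span_unit (P'w i j).
  exists (W *m T *m map_mx phi Ep).
  exists (row_mx (Y *m U2 + map_mx phi A *m U1) (Y *m T2 + map_mx phi A *m T1)).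
  have AE : map_mx phi A *m E = Y *m D - map_mx phi B *m W.
    by rewrite -WY addrK.
  rewrite map_mxM map_col_mx mul_row_col !mulmxDl -!mulmxA -rel1 -rel2.
  rewrite !mulmxDr !mulmxN !mulmxA AE !mulmxBl opprB !addrA.
  rewrite [_ + Y *m T2 *m _]addrAC subrK -[in RHS](addrA _ (map_mx phi A *m _)).
  rewrite [in RHS](addrC (_ - _) (_ + _)) -(addrA _ (- _) (Y *m T2 *m _)).
  by rewrite [- _ + _]addrC -[_ - Y *m D *m _ *m _]opprB addrK.
Qed.

End TypeDescent.

(** * Countable extensions of partial sections *)

Definition pure_submodule (R : pzRingType) (M : lmodType R) (K : M -> Prop) : Prop :=
  forall l k (A : 'M[R]_(l, k)) (w : 'cV[M]_k), allin K (A *v w) ->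
    exists2 v, allin K v & A *v v = A *v w.

Definition pure_epi (R : pzRingType) (G P : lmodType R) (f : G -> P) : Prop :=
  forall l n (D : 'M[R]_(l, n)) (z : 'cV[P]_n), D *v z = 0 ->
    exists2 z' : 'cV[G]_n, D *v z' = 0 & map_mx f z' = z.

(** With [K = 0] this says that the kernel of a pure epimorphism is pure.  A
    solution modulo [K] is corrected by lifting the difference of two solutions
    in [P] of the same system. *)
Lemma pure_submodule_preim (R : pzRingType) (G P : lmodType R) (f : {linear G -> P})
  (K : P -> Prop) :
  pure_epi f -> pure_submodule K -> pure_submodule (fun g => K (f g)).
Proof.
move=> fpure Kpure l k A w Kw.
have [v Kv Av] : exists2 v, allin K v & A *v v = A *v map_mx f w.
  by apply: Kpure; rewrite -map_act; exact: allin_map Kw.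
have [|u Au fu] := fpure l k A (v - map_mx f w); first by rewrite actBr Av subrr.
exists (w + u); last by rewrite actDr Au addr0.
move=> i j; have := Kv i j; rewrite -(subrK (map_mx f w) v) -fu addrC.
by rewrite -map_mxD mxE.
Qed.

Section CountableExtension.
Context {R : pzRingType} {G P : lmodType R} (f : {linear G -> P}).
Hypothesis fpure : pure_epi f.
Variables (K : P -> Prop).
Hypotheses (sK : submod K) (Kpure : pure_submodule K).
Hypothesis Ktype : forall n (b : 'cV[P]_n), type_generated K b.

(** A finite tuple of [P] together with a formula that generates its type modulo
    [K], and a solution of this formula in [G]; the solution provides lifts of
    the tuple along [f], up to [K].  Any relation modulo [K] between the elements
    of the tuple holds exactly between these lifts. *)
Record stage := Stage {
  stage_n : nat; stage_N : nat; stage_L : nat;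
  stage_gens : 'cV[P]_stage_n;
  stage_E : 'M[R]_(stage_n, stage_N);
  stage_D : 'M[R]_(stage_L, stage_N);
  stage_sol : 'cV[G]_stage_N }.

Definition stage_lift (s : stage) := stage_E s *v stage_sol s.

Definition stage_valid (s : stage) : Prop :=
  [/\ stage_D s *v stage_sol s = 0,
      allin K (map_mx f (stage_lift s) - stage_gens s) &
      forall l k (A : 'M[R]_(l, stage_n s)) (B : 'M[R]_(l, k)) (w : 'cV[P]_k),
        allin K (A *v stage_gens s + B *v w) ->
        exists W Y, A *m stage_E s + B *m W = Y *m stage_D s].

(** The formula generating the type of the old tuple implies the formula that
    says that the old tuple can be completed to one satisfying the new generating
    formula, so the old lifts can be completed in [G].  Such a completion need
    not lift the new elements; it is compared with an arbitrary lift [h0] of the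
    new solution, and the difference is moved into the preimage of [K], which is
    pure. *)
Lemma stage_extend (s : stage) q (t : 'cV[P]_q) : stage_valid s ->
  exists s', [/\ stage_valid s',
    exists Sel : 'M[R]_(stage_n s, stage_n s'),
      stage_gens s = Sel *v stage_gens s' /\ stage_lift s = Sel *v stage_lift s' &
    forall i, exists i', stage_gens s' i' 0 = t i 0].
Proof.
case: s => n N L c E D sol [/= Dsol]; rewrite /stage_lift /= => Kc imp.
have [N' [L' [E' [D' [z [Kz Dz imp']]]]]] := Ktype (col_mx c t).
have [v Kv Dv] := Kpure Dz.
pose z' := z - v.
have Dz' : D' *v z' = 0 by rewrite actBr Dv subrr.
have Kz' : allin K (col_mx c t - E' *v z').
  by rewrite actBr opprB addrC addrAC -addrA; apply: allinD => //; apply: allin_act.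
have [h0 Dh0 fh0] := fpure Dz'.
rewrite -[E']vsubmxK in Kz Kz' imp' *.
move: (usubmx E') (dsubmx E') Kz Kz' imp' => E0 E1 {E'} Kz Kz' imp'.
have [W [Y WY]] : exists W Y, col_mx 1%:M 0 *m E + col_mx (- E0) D' *m W = Y *m D.
  apply: (imp _ _ _ _ z); rewrite !act_col act1 act0l add_col_mx add0r actNl.
  apply/allin_col; split=> //; move: Kz.
  by rewrite act_col opp_col_mx add_col_mx => /allin_col[].
move: WY; rewrite -[Y]vsubmxK; move: (usubmx Y) (dsubmx Y) => Y1 Y2 {Y}.
rewrite !mul_col_mx mul1mx mul0mx add_col_mx add0r mulNmx => /eq_col_mx[EW DW].
pose d0 := W *v sol - h0.
have E0W : E0 *v (W *v sol) = E *v sol.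
  by apply/eqP; rewrite actA eq_sym -subr_eq0 -actBl EW -actA Dsol act0r.
have D'W : D' *v (W *v sol) = 0 by rewrite actA DW -actA Dsol act0r.
have [|d Kd Ed] := pure_submodule_preim fpure Kpure (A := col_mx E0 D') (w := d0).
  rewrite act_col; apply/allin_col; split.
    rewrite actBr E0W; have := Kz'; rewrite act_col opp_col_mx add_col_mx.
    case/allin_col => Kc' _; have := allinD sK Kc Kc'.
    rewrite -fh0 -map_act addrA subrK -map_mxB => KE i j.
    by have := KE i j; rewrite mxE.
  by rewrite actBr D'W Dh0 subrr => i j; rewrite mxE linear0; case: sK.
move: Ed; rewrite !act_col => /eq_col_mx[Ed Dd].
exists (Stage (col_mx c t) (col_mx E0 E1) D' (h0 + d)); split=> /=.
- split=> //=; first by rewrite actDr Dh0 Dd actBr D'W Dh0 subrr addr0.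
  rewrite /stage_lift /= map_act map_mxD fh0 actDr addrAC.
  apply: allinD => //; last first.
    by apply: allin_act => // i j; rewrite mxE; exact: Kd.
  by rewrite -opprB; apply: allinN.
- exists (row_mx 1%:M 0); rewrite /stage_lift /= act_col !act_row_col !act1 !act0l !addr0.
  by split=> //; rewrite actDr Ed actBr E0W addrC subrK.
- by move=> i; exists (rshift n i); rewrite col_mxEd.
Qed.

Lemma stage_start q (t : 'cV[P]_q) : 
  exists2 s, stage_valid s & forall i, exists i', stage_gens s i' 0 = t i 0.
Proof.
pose s0 := @Stage 0 0 0 0 0 0 0.
have v0 : stage_valid s0.
  split; [exact: mx0rows | by case |].
  by move=> l k A B w _; exists 0, 0; exact: mx0cols.
by have [s [? _ ?]] := stage_extend t v0; exists s.
Qed.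

Variables (X : G -> Prop).
Hypotheses (sX : submod X) (injX : forall x, X x -> f x = 0 -> x = 0).
Hypothesis XK : forall p, K p <-> exists2 x, X x & f x = p.

(** Iterate [stage_extend], adding at each step the images of the current solution
    and the values of [next] on the current tuple.  Adding the former makes the
    new image pure: a system solvable in [P] with right-hand sides in the span
    of a stage is implied by its generating formula, hence solvable in terms of
    the witness of the latter, which belongs to the next stage. *)
Lemma countable_extension (next : P -> seq P) (p0 : P) :
  exists (X' : G -> Prop) (C : P -> Prop),
    let K' p := exists2 x, X' x & f x = p in
    [/\ submod X', forall x, X x -> X' x,
        forall x, X' x -> f x = 0 -> x = 0 & pure_submodule K'] /\
    [/\ C p0, forall c p, C c -> p \in next c -> C p, forall c, C c -> K' c &
        forall Z, submod Z -> (forall p, K p -> Z p) -> (forall c, C c -> Z c) ->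
          forall p, K' p -> Z p].
Proof.
have step (s : {s | stage_valid s}) : exists s' : {s | stage_valid s},
    [/\ exists Sel : 'M[R]_(stage_n (sval s), stage_n (sval s')),
      stage_gens (sval s) = Sel *v stage_gens (sval s') /\
      stage_lift (sval s) = Sel *v stage_lift (sval s'),
      forall j, exists i, stage_gens (sval s') i 0 = f (stage_sol (sval s) j 0) &
      forall i p, p \in next (stage_gens (sval s) i 0) ->
        exists i', stage_gens (sval s') i' 0 = p].
  case: s => s vs.
  pose l := flatten [seq next (stage_gens s i 0) | i <- enum 'I_(stage_n s)].
  pose t := col_mx (map_mx f (stage_sol s)) (\col_(i < size l) l`_i).
  have [s' [vs' Sel st]] := stage_extend t vs; exists (exist _ s' vs') => /=; split=> //.
    move=> j; have [i E] := st (lshift _ j); exists i.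
    by rewrite E col_mxEu mxE.
  move=> i p pi; have pl : p \in l.
    by apply/flattenP; exists (next (stage_gens s i 0)) => //; apply: map_f; rewrite mem_enum.
  have pl' : (index p l < size l)%N by rewrite index_mem.
  have [i' E] := st (rshift _ (Ordinal pl')); exists i'.
  by rewrite E col_mxEd mxE nth_index.
have [nxt nxtP] := choice step.
have [s0 vs0 s0P] := stage_start (p0%:M : 'cV_1).
pose s := fix s k : {s | stage_valid s} :=
  if k is k'.+1 then nxt (s k') else exist _ s0 vs0.
pose gens k := stage_gens (sval (s k)); pose lift k := stage_lift (sval (s k)).
have valid k : stage_valid (sval (s k)) by exact: (svalP (s k)).
(* [U k] is the part of the new submodule of [G] reached at stage [k], and
   [V k] its image in [P] *)
pose U k g := exists A : 'rV[R]_(stage_n (sval (s k))), X (g - (A *v lift k) 0 0).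
pose V k p := exists A : 'rV[R]_(stage_n (sval (s k))), K (p - (A *v gens k) 0 0).
have chain k : exists Sel : 'M[R]_(stage_n (sval (s k)), stage_n (sval (s k.+1))),
    gens k = Sel *v gens k.+1 /\ lift k = Sel *v lift k.+1.
  by have [] := nxtP (s k).
have US k g : U k g -> U k.+1 g.
  move=> [A XA]; have [Sel [_ E]] := chain k.
  by exists (A *m Sel); rewrite -actA -E.
have Ule i j g : (i <= j)%N -> U i g -> U j g.
  by move=> /subnKC <- Ui; elim: (j - i)%N => [|d IH]; rewrite ?addn0 ?addnS //; apply: US.
have sU k : submod (U k).
  have [X0 XD XZ] := sX; split=> [|x y [A XA] [B XB]|a x [A XA]].
  - by exists 0; rewrite act0l mxE subrr.
  - by exists (A + B); rewrite actDl mxE opprD addrACA; apply: XD.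
  - exists (a *: A); have := XZ a _ XA; rewrite scalerBr; congr (X (_ - _)).
    by rewrite actZl_entry.
have fA k (A : 'rV_(stage_n (sval (s k)))) :
    (A *v (map_mx f (lift k) - gens k)) 0 0 = f ((A *v lift k) 0 0) - (A *v gens k) 0 0.
  by rewrite actBr -map_act mxE [X in X + _]mxE [X in _ + X]mxE.
have KA k (A : 'rV_(stage_n (sval (s k)))) :
    K (f ((A *v lift k) 0 0) - (A *v gens k) 0 0).
  by rewrite -fA; apply: allin_act => //; case: (valid k).
have UV k g : U k g -> V k (f g).
  move=> [A XA]; exists A.
  have KX : K (f (g - (A *v lift k) 0 0)) by apply/XK; exists (g - (A *v lift k) 0 0).
  have [_ KD _] := sK; have := KD _ _ KX (KA k A).
  by rewrite linearB addrA subrK.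
have VU k p : V k p -> exists2 g, U k g & f g = p.
  move=> [A Kp]; have /XK[x Xx xE] := submodB sK Kp (KA k A).
  exists (x + (A *v lift k) 0 0); first by exists A; rewrite addrK.
  by rewrite linearD xE opprB addrA !subrK.
pose X' g := exists k, U k g.
pose C p := exists k i, gens k i 0 = p.
pose K' p := exists2 x, X' x & f x = p.
have sX' : submod X'.
  split=> [|x y [i Ux] [j Uy]|a x [i Ux]].
  - by exists 0%N; case: (sU 0%N).
  - exists (maxn i j); case: (sU (maxn i j)) => _ UD _.
    by apply: UD; [apply: Ule Ux; exact: leq_maxl | apply: Ule Uy; exact: leq_maxr].
  - by exists i; case: (sU i) => _ _; apply.
have sK' : submod K'.
  have [X0 XD XZ] := sX'; split=> [|_ _ [x Xx <-] [y Xy <-]|a _ [x Xx <-]].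
  - by exists 0; rewrite ?linear0.
  - by exists (x + y); rewrite ?linearD //; apply: XD.
  - by exists (a *: x); rewrite ?linearZ //; apply: XZ.
have VK' k p : V k p -> K' p.
  by move=> /VU[g Ug gE]; exists g => //; exists k.
have K'V p : K' p -> exists k, V k p.
  by case=> x [k /UV Vx] <-; exists k.
have Vle i j p : (i <= j)%N -> V i p -> V j p.
  by move=> ij /VU[g Ug <-]; apply: UV; apply: Ule Ug.
have KK' p : K p -> K' p.
  by move=> Kp; apply: (VK' 0%N); exists 0; rewrite act0l mxE subr0.
have CK' c : C c -> K' c.
  move=> [k [i <-]]; apply: (VK' k); exists (delta_mx 0 i).
  have -> : ((delta_mx 0 i : 'rV_(_)) *v gens k) 0 0 = gens k i 0; last by rewrite subrr; case: sK.
  by rewrite -row1 -act_row act1 mxE.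
exists X', C; split; split=> //.
- by move=> x Xx; exists 0%N, 0; rewrite act0l mxE subr0.
- move=> x [k [A XA]] fx0; have [Dsol Kl imp] := valid k.
  have Kg : allin K (A *v gens k + (0 : 'M_(1, 0)) *v (0 : 'cV_0)).
    rewrite act0l addr0 -[gens k](subKr (map_mx f (lift k))) actBr.
    apply: allinB => //; last exact: allin_act.
    have KX : K (f (x - (A *v lift k) 0 0)) by apply/XK; exists (x - (A *v lift k) 0 0).
    move=> i j; rewrite !ord1 -map_act mxE.
    by rewrite -[f _]opprK; apply: submodN => //; rewrite -[X in K X]add0r -fx0 -linearB.
  have [W [Y WY]] := imp _ _ _ _ _ Kg.
  have lift0 : A *v lift k = 0.
    move: WY; rewrite mul0mx addr0 => WY.
    by rewrite /lift /stage_lift actA WY -actA Dsol act0r.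
  by move: XA; rewrite lift0 mxE subr0 => Xx; apply: injX.
- move=> l q A w K'w.
  have [k [Cm KC]] : exists k (Cm : 'M_(l, _)), allin K (A *v w - Cm *v gens k).
    have [n Vn] : exists n, forall i, V n ((A *v w) i 0).
      have [h hP] := choice (fun i => K'V _ (K'w i 0)).
      by exists (\max_i h i) => i; apply: Vle (hP i); exact: leq_bigmax.
    have [Cm CmP] := matrix_rows_choice Vn.
    exists n, Cm => i j; rewrite !ord1 [X in K X]mxE [X in K (_ + X)]mxE.
    have := CmP i; rewrite -act_row.
    by rewrite [row _ _ 0 0]mxE.
  have [Dsol Kl imp] := valid k.
  have [W [Y WY]] : exists W Y, Cm *m stage_E (sval (s k)) + (- A) *m W
      = Y *m stage_D (sval (s k)).
    apply: (imp _ _ _ _ w); rewrite actNl -opprB opprD opprK addrC.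
    by rewrite -opprB; apply: allinN => //; rewrite opprB addrC.
  pose z := map_mx f (stage_sol (sval (s k))).
  have Dz : stage_D (sval (s k)) *v z = 0 by rewrite -map_act Dsol map_mx0 ?linear0.
  have CE : Cm *v (stage_E (sval (s k)) *v z) = A *v (W *v z).
    apply/eqP; rewrite -subr_eq0 !actA -actBl -mulNmx WY -actA Dz act0r.
    by [].
  have [v Kv Av] : exists2 v, allin K v & A *v v = A *v (w - W *v z).
    apply: Kpure; rewrite actBr -CE.
    rewrite -[A *v w](subrK (Cm *v gens k)) -addrA -actBr; apply: allinD => //.
    apply: allin_act => //; rewrite -opprB; apply: allinN => //.
    by rewrite -map_act.
  exists (W *v z + v); last by rewrite actDr Av actBr addrC subrK.
  apply: allinD => //; last by move=> i j; apply: KK'.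
  apply: allin_act => // j j'; rewrite ord1; apply: CK'.
  have [_ /(_ j)[i E] _] := nxtP (s k).
  by exists k.+1, i; rewrite /gens /= E mxE.
- by exists 0%N; have [i E] := s0P 0; exists i; rewrite /gens /= E mxE.
- move=> c p [k [i <-]] pn; have [_ _ /(_ i p pn)[i' E]] := nxtP (s k).
  by exists k.+1, i'.
- move=> Z sZ KZ CZ p /K'V[k [A /KZ Zp]].
  have [_ ZD _] := sZ; rewrite -(subrK ((A *v gens k) 0 0) p).
  apply: ZD => //; apply: allin_act => // i j; rewrite ord1.
  by apply: CZ; exists k, i.
Qed.

End CountableExtension.

(** * Splitting a pure epimorphism *)

Section Cokernel.
Context {R : pzRingType} {k n : nat} (A : 'M[R]_(k, n)).

Fact row_image_submod : submod (fun x : 'rV[R]_n => exists z : 'rV_k, z *m A = x).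
Proof.
split=> [|_ _ [z <-] [t <-]|a _ [z <-]].
- by exists 0; rewrite mul0mx.
- by exists (z + t); rewrite mulmxDl.
- by exists (a *: z); rewrite scalemxAl.
Qed.

Definition cokernel := quotient_module (Submodule row_image_submod).
HB.instance Definition _ := GRing.Lmodule.on cokernel.

Definition cokernel_class : {linear 'rV[R]_n -> cokernel} :=
  @quotient_class R 'rV[R]_n (Submodule row_image_submod).

Definition cokernel_gens : 'cV[cokernel]_n := \col_j cokernel_class (delta_mx 0 j).

Lemma act_cokernel_gens (x : 'rV[R]_n) : (x *v cokernel_gens) 0 0 = cokernel_class x.
Proof. by rewrite [RHS]linear_rV. Qed.

Lemma cokernel_class_eq0 x : cokernel_class x = 0 <-> exists z : 'rV_k, z *m A = x.
Proof. exact: quotient_class_eq0. Qed.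

Lemma cokernel_presents : presents cokernel_gens A.
Proof.
split.
- move=> N y; have [W WP] := matrix_rows_choice
    (Q := fun i x => cokernel_class x = y i 0) (fun i => ex_intro _ _ (quotient_class_repr (y i 0))).
  exists W; apply/matrixP => i j; rewrite ord1 -WP -act_cokernel_gens -act_row.
  by rewrite [LHS]mxE.
- move=> h X Xe.
  have Xr i : exists z, z *m A = row i X.
    by apply/cokernel_class_eq0; rewrite -[LHS]act_cokernel_gens -act_row Xe row0 mxE.
  have [B BP] := matrix_rows_choice Xr; exists B; apply/row_matrixP => i.
  by rewrite row_mul BP.
- apply/row_matrixP => i; rewrite act_row row0; apply/matrixP => a b.
  rewrite !ord1 act_cokernel_gens mxE; apply/cokernel_class_eq0.
  by exists (delta_mx 0 i); rewrite -rowE.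
Qed.

Lemma cokernel_lift (P : lmodType R) (z : 'cV[P]_n) :
  A *v z = 0 -> exists h : {linear cokernel -> P}, map_mx h cokernel_gens = z.
Proof.
move=> Az; have lg : linear (fun x : 'rV[R]_n => (x *v z) 0 0).
  by move=> a x y; rewrite actDl mxE actZl_entry.
have [g gE] := linear_ex lg.
have [|h hE] := @quotient_lift _ _ (Submodule row_image_submod) _ g.
  by move=> _ [x <-]; rewrite gE -actA Az act0r mxE.
exists h; apply/matrixP => i j; rewrite ord1 !mxE [LHS]hE gE.
by rewrite -row1 -act_row act1 mxE.
Qed.

End Cokernel.

(** One summand for every finite system of relations satisfied in [P], namely the
    module that it presents, makes the sum of the induced maps to [P] pure. *)
Lemma pure_presentation (R : pzRingType) (P : lmodType R) :
  exists (I : Type) (F : I -> lmodType R) (f : {linear direct_sum F -> P}),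
    (forall i, finitely_presented (F i)) /\ pure_epi f.
Proof.
pose I := {k : nat & {n : nat & {A : 'M[R]_(k, n) & {z : 'cV[P]_n | A *v z = 0}}}}.
pose mat (i : I) := projT1 (projT2 (projT2 i)).
pose sol (i : I) := sval (projT2 (projT2 (projT2 i))).
have solP i : mat i *v sol i = 0 by exact: (svalP (projT2 (projT2 (projT2 i)))).
pose F i : lmodType R := cokernel (mat i).
pose h i := projT1 (cid (cokernel_lift (solP i))).
have hE i : map_mx (h i) (cokernel_gens (mat i)) = sol i.
  exact: (projT2 (cid (cokernel_lift (solP i)))).
have [f fE] := direct_sum_lift (h : forall i, {linear F i -> P}).
exists I, F, f; split=> [i|l n D z Dz].
  apply/finitely_presentedP.
  by exists _, _, (cokernel_gens (mat i)), (mat i); exact: cokernel_presents.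
pose i : I := existT _ l (existT _ n (existT _ D (exist _ z Dz))).
have [_ _ De] := cokernel_presents D.
exists (map_mx (@single _ _ F i) (cokernel_gens D)).
  by rewrite -map_act De map_mx0.
by rewrite -[RHS](hE i) -map_mx_comp; apply: eq_map_mx => x; exact: fE.
Qed.

(** A submodule of [G] mapped bijectively onto [P] is the graph of a section. *)
Lemma transversal_section (R : pzRingType) (G P : lmodType R) (f : {linear G -> P})
  (X : G -> Prop) :
  submod X -> (forall x, X x -> f x = 0 -> x = 0) ->
  (forall p, exists2 x, X x & f x = p) ->
  exists s : {linear P -> G}, cancel s f.
Proof.
move=> sX injX surjX.
have [s sP] := choice (fun p => (let: ex_intro2 x Xx xE := surjX p in
  ex_intro (fun x => X x /\ f x = p) x (conj Xx xE))).
have [X0 XD XZ] := sX.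
have ls : linear s.
  move=> a p q; apply/eqP; rewrite -subr_eq0; apply/eqP; apply: injX.
    apply: submodB => //; first by case: (sP (a *: p + q)).
    by apply: XD; [apply: XZ; case: (sP p) | case: (sP q)].
  by rewrite linearB linearP !(sP _).2 subrr.
have [s' s'E] := linear_ex ls; exists s' => p.
by rewrite s'E (sP p).2.
Qed.

Section Descent.
Context {R S : comPzRingType} (phi : {rmorphism R -> S}) (P : lmodType R).
Hypothesis phi_pure : pure_morphism phi.
Variables (I : Type) (F : I -> lmodType S).
Hypothesis Ffp : forall i, finitely_presented (F i).
Variables (iota : {linear tensor phi P -> direct_sum F})
          (rho : {linear direct_sum F -> tensor phi P}).
Hypothesis iotaK : cancel iota rho.
Variables (G : lmodType R) (f : {linear G -> P}).
Hypothesis fpure : pure_epi f.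
Local Notation tau := (unit_tensor phi (P := P)).
Local Notation span := (@tensor_span R S phi P).

Lemma tensor_span_mono (K K' : P -> Prop) u :
  (forall p, K p -> K' p) -> span K u -> span K' u.
Proof.
move=> KK' [n [p [s [Kp uE]]]]; exists n, p, s; split=> //.
by move=> i j; apply: KK'.
Qed.

Lemma supported_span (J : I -> Prop) (K : P -> Prop) u :
  (forall p, K p -> supported J (iota (tau p))) ->
  span K u -> supported J (iota u).
Proof.
move=> KJ [n [p [s [Kp uE]]]].
have -> : u = (s *v map_mx tau p) 0 0 by rewrite -uE mxE eqxx mulr1n.
have : allin (supported J) (map_mx iota (s *v map_mx tau p)).
  rewrite map_act; apply: allin_act; first exact: supported_submod.
  by move=> i j; rewrite !mxE; apply: KJ.
by move/(_ 0 0); rewrite mxE.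
Qed.

Lemma span_supported (J : I -> Prop) (K : P -> Prop) :
  (forall i (y : F i), J i -> span K (rho (single y))) ->
  forall d, supported J d -> span K (rho d).
Proof.
move=> KJ d Jd; have [T0 TD TZ] := tensor_span_submod phi K.
apply: (direct_sum_span (K := fun d => span K (rho d))).
  split=> [|x y Kx Ky|a x Kx]; first by rewrite linear0.
    by rewrite linearD; apply: TD.
  by rewrite linearZ; apply: TZ.
move=> i; have [Ji|nJi] := pselect (J i); first exact: KJ.
by rewrite Jd // !linear0.
Qed.

(** A finite generating tuple of [F i] is mapped by [rho] to tensors that involve
    only finitely many elements of [P]. *)
Lemma finitely_many_tensors i : exists l : seq P,
  forall K (y : F i), submod K -> (forall p, p \in l -> K p) ->
    span K (rho (single y)).
Proof.
have [n [k [e [A [esurj _ _]]]]] := (finitely_presentedP.1 (Ffp i)).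
pose x := map_mx rho (map_mx (@single _ _ F i) e).
have [q [p [T [_ xE]]]] := tensor_span_tuple (fun a b => tensor_span_setT (x a b)).
exists [seq p j 0 | j <- enum 'I_q] => K y sK Kp.
have [W /matrixP/(_ 0 0)] := esurj 1%N (y%:M); rewrite mxE eqxx mulr1n => ->.
exists q, p, (W *m T); split.
  by move=> a b; rewrite ord1; apply: Kp; apply: map_f; rewrite mem_enum.
rewrite -actA -xE /x -!map_act; apply/matrixP => a b.
by rewrite !ord1 [in LHS]mxE eqxx mulr1n [in RHS]mxE [in RHS]mxE.
Qed.

(** A section of [f] over a submodule [ps_image] of [P] is encoded by its image
    [ps_set].  By the last two fields, [iota] and [rho] restrict to maps between
    the [S]-span of [tau ps_image] and the part of the direct sum supported in
    [ps_index], so that the quotient of the tensor product by the former is a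
    retract of the direct sum of the remaining summands. *)
Record partial_section := PartialSection {
  ps_index : I -> Prop;
  ps_set : G -> Prop;
  ps_image := fun p => exists2 x, ps_set x & f x = p;
  ps_submod : submod ps_set;
  ps_inj : forall x, ps_set x -> f x = 0 -> x = 0;
  ps_pure : pure_submodule ps_image;
  ps_supported : forall p, ps_image p -> supported ps_index (iota (tau p));
  ps_span : forall i (y : F i), ps_index i ->
    span ps_image (rho (single y)) }.

Lemma image_submod (X : G -> Prop) : submod X -> submod (fun p => exists2 x, X x & f x = p).
Proof.
move=> [X0 XD XZ]; split=> [|_ _ [x Xx <-] [y Xy <-]|a _ [x Xx <-]].
- by exists 0; rewrite ?linear0.
- by exists (x + y); rewrite ?linearD //; apply: XD.
- by exists (a *: x); rewrite ?linearZ //; apply: XZ.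
Qed.

(** [P] modulo the image of such a section is a Mittag-Leffler module, since this
    holds for the direct sum modulo its part supported in [ps_index]. *)
Lemma ps_type_generated (s : partial_section) n (b : 'cV[P]_n) :
  type_generated (ps_image s) b.
Proof.
apply: (type_generated_descent phi_pure); first exact: image_submod (ps_submod s).
apply: (type_generated_retract (K' := supported (ps_index s)) iotaK).
- by move=> x; apply: supported_span; exact: ps_supported.
- by apply: span_supported; exact: ps_span.
- exact: direct_sum_type_generated.
Qed.

Definition ps_le (s t : partial_section) : bool :=
  `[< (forall i, ps_index s i -> ps_index t i) /\ (forall x, ps_set s x -> ps_set t x) >].

(** The operation [next] adds to each [c] the elements needed to generate by
    tensors the images of the finitely many summands that meet [iota (tau c)];
    these summands are then added to the index set. *)
Lemma ps_extend (s : partial_section) (p0 : P) :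
  exists2 t, ps_le s t & ps_image t p0.
Proof.
have nextP c : exists l : seq P, forall i, component i (iota (tau c)) <> 0 ->
    forall K (y : F i), submod K -> (forall p, p \in l -> K p) ->
    span K (rho (single y)).
  have [h hP] := choice finitely_many_tensors.
  have [ls [_ lsP]] := direct_sum_support (iota (tau c)).
  exists (flatten [seq h i | i <- ls]) => i /lsP ils K y sK Kl.
  apply: (hP i) => // p pi; apply: Kl; apply/flattenP; exists (h i) => //.
  exact: (@map_f {classic I} _ h ls i ils).
have [next {}nextP] := choice nextP.
have [X [C [[sX sub inj pureX] [C0 Cnext CX gen]]]] := countable_extension fpure
  (image_submod (ps_submod s)) (@ps_pure s) (ps_type_generated s) (ps_submod s)
  (@ps_inj s) (fun p => iff_refl _) next p0.
pose J i := ps_index s i \/ exists2 c, C c & component i (iota (tau c)) <> 0.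
have sK := image_submod sX.
have supJ p : (exists2 x, X x & f x = p) -> supported J (iota (tau p)).
  apply: (gen (fun q => supported J (iota (tau q))) _ _ _ p).
  - have [J0 JD JZ] := @supported_submod _ _ F J.
    split=> [|x y Jx Jy|a x Jx]; first by rewrite !raddf0.
      by rewrite !raddfD; apply: JD.
    by rewrite unit_tensorZ linearZ; apply: JZ.
  - by move=> q sq i nJi; apply: (ps_supported sq) => Ji; apply: nJi; left.
  - move=> c Cc i nJi; apply: contrapT => nz; apply: nJi; right.
    by exists c.
have spanJ i (y : F i) : J i -> span (fun p => exists2 x, X x & f x = p) (rho (single y)).
  case=> [/(ps_span y)|[c Cc nz]].
    by apply: tensor_span_mono => _ [x sx <-]; exists x => //; apply: sub.
  apply: (nextP c i nz) => // p pn; apply: CX; exact: Cnext Cc pn.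
exists (PartialSection sX inj pureX supJ spanJ); last exact: CX.
by apply/asboolP; split=> // i si; left.
Qed.

Lemma ps_empty : exists s : partial_section, True.
Proof.
have pure0 : pure_submodule (fun p => exists2 x, x = 0 & f x = p).
  move=> l k A w Aw; exists 0.
    by move=> i j; exists 0; rewrite ?linear0 ?mxE.
  by rewrite act0r; apply/esym/matrixP => i j; have [x -> <-] := Aw i j; rewrite linear0 mxE.
have sup0 p : (exists2 x, x = 0 & f x = p) -> supported (fun=> False) (iota (tau p)).
  by move=> [x -> <-] i _; rewrite linear0 !raddf0.
have span0 i (y : F i) : False -> span
    (fun p => exists2 x, x = 0 & f x = p) (rho (single y)) by [].
by exists (PartialSection submod0 (fun x Xx _ => Xx) pure0 sup0 span0).
Qed.

Lemma ps_chain (A : set partial_section) :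
  total_on A (fun s t => ps_le s t) -> (exists s, A s) ->
  exists t, forall s, A s -> ps_le s t.
Proof.
move=> totA [s0 As0].
pose J i := exists2 s, A s & ps_index s i.
pose X x := exists2 s, A s & ps_set s x.
have sX : submod X.
  split=> [|x y [s As sx] [t At ty]|a x [s As sx]].
  - by exists s0 => //; case: (ps_submod s0).
  - have [/asboolP[_ st]|/asboolP[_ ts]] := totA _ _ As At.
      by exists t => //; case: (ps_submod t) => _ tD _; apply: tD => //; apply: st.
    by exists s => //; case: (ps_submod s) => _ sD _; apply: sD => //; apply: ts.
  - by exists s => //; case: (ps_submod s) => _ _; apply.
have inj x : X x -> f x = 0 -> x = 0 by case=> s _; exact: ps_inj.
pose K p := exists2 x, X x & f x = p.
have sub s p : A s -> ps_image s p -> K p.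
  by move=> As [x sx <-]; exists x => //; exists s.
have fin n (w : 'cV[P]_n) : allin K w -> exists2 s, A s & allin (ps_image s) w.
  elim: n w => [|n IH] w; first by exists s0 => // -[].
  move: w; rewrite -[n.+1]/(1 + n)%N => w; rewrite -[w]vsubmxK => /allin_col[Ku /IH[s As sd]].
  have [x [t At tx] xE] := Ku 0 0.
  have tu : allin (ps_image t) (usubmx w) by move=> i j; rewrite !ord1; exists x.
  have [/asboolP[_ st]|/asboolP[_ ts]] := totA _ _ As At.
    exists t => //; apply/allin_col; split=> // i j.
    by have [y sy yE] := sd i j; exists y => //; apply: st.
  exists s => //; apply/allin_col; split=> // i j.
  by have [y sy yE] := tu i j; exists y => //; apply: ts.
have pureX : pure_submodule K.
  move=> l k B w /fin[s As /(@ps_pure s)[v sv Bv]]; exists v => //.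
  by move=> i j; apply: sub (sv i j).
have supJ p : K p -> supported J (iota (tau p)).
  move=> [x [s As sx] xE] i nJi; apply: (@ps_supported s); first by exists x.
  by move=> si; apply: nJi; exists s.
have spanJ i (y : F i) : J i -> span K (rho (single y)).
  by move=> [s As /(ps_span y)]; apply: tensor_span_mono => p; exact: sub.
exists (PartialSection sX inj pureX supJ spanJ) => s As; apply/asboolP.
by split=> [i si|x sx]; exists s.
Qed.

Lemma pure_epi_splits : exists s : {linear P -> G}, cancel s f.
Proof.
have [s0 _] := ps_empty.
have [||A totA|s smax] := ZL_preorder s0 (R := ps_le).
- by move=> s; apply/asboolP.
- move=> r s t /asboolP[rs1 rs2] /asboolP[st1 st2]; apply/asboolP.
  by split=> z h; [apply: st1; apply: rs1 | apply: st2; apply: rs2].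
- have [A0|nA] := pselect (exists s, A s); first exact: ps_chain.
  by exists s0 => s As; case: nA; exists s.
apply: (transversal_section (ps_submod s) (@ps_inj s)) => p.
have [t st [x tx xE]] := ps_extend s p.
have /asboolP[_ ts] := smax t st.
by exists x => //; apply: ts.
Qed.

End Descent.

Theorem pure_projective_descent (R S : comPzRingType) (phi : {rmorphism R -> S})
  (P : lmodType R) :
  pure_morphism phi -> pure_projective (tensor phi P : lmodType S) ->
  pure_projective P.
Proof.
move=> phi_pure [I [F [Ffp /summand_retract[iota [rho iotaK]]]]].
have [I' [F' [f [F'fp fpure]]]] := pure_presentation P.
exists I', F'; split=> //.
have [s sK] := pure_epi_splits phi_pure Ffp iotaK fpure.
exact: retract_summand sK.
Qed.

Theorem corollary9p7 (R : comNzRingType) (m : ideal R)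
    (noethR : noetherian R) (localR : local_ring m) (P : lmodType R) :
  pure_projective P <->
  pure_projective (tensor (to_completion m) P : lmodType (completion m)).
Proof.
split; first exact: tensor_pure_projective.
by apply: pure_projective_descent; exact: completion_pure.
Qed.
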